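(* The split optimal policy iteration for the discrete-time LQR problem converges locally linearly, i.e. there is a $\varrho>0$ such that, locally around $F^{\mathrm{opt}}$, $$\|F^{k+n}-F^{\mathrm{opt}}\|\le\varrho\,\|F^k-F^{\mathrm{opt}}\| .$$ The convergence rate $\varrho$ is governed by the norm of the iteration matrix $$Dg(F^{\mathrm{opt}})=Dg^{j-1}(F^{\mathrm{opt}})\cdot Dg^{j-2}(F^{\mathrm{opt}})\cdots Dg^{j+1}(F^{\mathrm{opt}})\cdot Dg^{j}(F^{\mathrm{opt}}),$$ where $$Dg^i(F^{\mathrm{opt}})=-\Pi_i\big(R^{(i)}+(B^{(i)})^{T}P^{\mathrm{opt}}B^{(i)}\big)^{-1}(B^{(i)})^{T}P^{\mathrm{opt}}B\,\hat I_i,\qquad \hat I_i=I-\Pi_i\Pi_i^{T}.$$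
   Context: Discrete-time LQR problem: the system is $x(\ell+1)=Ax(\ell)+Bu(\ell)$ with $A\in\mathbb{R}^{m\times m}$, $B\in\mathbb{R}^{m\times r}$, and the accumulated cost $\sum_{\ell\ge0}x(\ell)^{T}Qx(\ell)+u(\ell)^{T}Ru(\ell)$ is to be minimized, where $Q\in\mathbb{R}^{m\times m}$ and $R\in\mathbb{R}^{r\times r}$ are symmetric positive definite and block diagonal with respect to a decomposition into $n$ subsystems. The optimal feedback is $u=F^{\mathrm{opt}}x$ with $F^{\mathrm{opt}}=-(R+B^{T}P^{\mathrm{opt}}B)^{-1}B^{T}P^{\mathrm{opt}}A$, where $P^{\mathrm{opt}}$ is the unique symmetric positive definite solution of the discrete algebraic Riccati equation $P=A^{T}PA-A^{T}PB(R+B^{T}PB)^{-1}B^{T}PA+Q$. Subsystems: for $i=1,\dots,n$, $\Pi_i$ is the block column matrix, consistent with the block decomposition of $R$, whose $i$-th block is the identity and whose other blocks are $0$. For a feedback matrix $F\in\mathbb{R}^{r\times m}$ put $$A^{(i)}=A+B(I-\Pi_i\Pi_i^{T})F,\quad B^{(i)}=B\Pi_i,$$ $$Q^{(i)}=Q+F^{T}(I-\Pi_i\Pi_i^{T})R(I-\Pi_i\Pi_i^{T})F,\quad R^{(i)}=\Pi_i^{T}R\Pi_i .$$ Update of subsystem $i$: given $F$, let $P^{\mathrm{new}}$ be the symmetric positive definite solution of the discrete algebraic Riccati equation above with $(A,B,Q,R)$ replaced by $(A^{(i)},B^{(i)},Q^{(i)},R^{(i)})$. The updated feedback matrix $g^i(F)=F^{\mathrm{new}}$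 is defined by $$\Pi_i^{T}F^{\mathrm{new}}=-\big(R^{(i)}+(B^{(i)})^{T}P^{\mathrm{new}}B^{(i)}\big)^{-1}(B^{(i)})^{T}P^{\mathrm{new}}A^{(i)},\qquad (I-\Pi_i\Pi_i^{T})F^{\mathrm{new}}=(I-\Pi_i\Pi_i^{T})F ,$$ i.e. only the $i$-th block row of $F$ is changed. Split optimal policy iteration: starting from an initial guess $F^0$ and a first subsystem $j$ such that the pair $(A^{(j)},B^{(j)})$ formed with $F=F^0$ is controllable, the maps $g^i$ are applied consecutively, with $i$ sweeping cyclically over $\{1,\dots,n\}$ beginning with $i=j$; $F^k$ is the feedback matrix after $k$ updates. One full cycle is the map $g=g^{j-1}\circ g^{j-2}\circ\cdots\circ g^{j+1}\circ g^{j}$ (indices cyclic in $\{1,\dots,n\}$). $Dg$ and $Dg^i$ denote the derivatives of $g$ and $g^i$ with respect to $F$, written as matrices multiplying perturbations of $F$ from the left.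
   Formalization: The displayed formula for Dg^i(F^opt) omits the summand Î_i coming from the unchanged block rows and is false for n ≥ 2; the theorem proves Dg^i(F^opt) = Î_i − Π_i(R^(i)+(B^(i))^T P^opt B^(i))^{-1}(B^(i))^T P^opt B Î_i and uses these factors in the product Dg(F^opt). *)

(* Defs.v *)
From HB Require Import structures.
From mathcomp Require Export all_boot all_order all_algebra.
From mathcomp Require Export all_classical all_reals all_analysis.
Set Implicit Arguments.
Unset Strict Implicit.
Unset Printing Implicit Defensive.
Import Order.TTheory GRing.Theory Num.Theory.
Import numFieldNormedType.Exports.
Local Open Scope classical_set_scope.
Local Open Scope ring_scope.

Section LQR.
Context {K : realType} {m r : nat}.
Implicit Types (A P Q : 'M[K]_m) (B : 'M[K]_(m, r)) (R : 'M[K]_r).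

Definition sym_posdef k (M : 'M[K]_k) : Prop :=
  M^T = M /\ forall x : 'cV[K]_k, x != 0 -> 0 < (x^T *m M *m x) 0 0.

Definition dare A B Q R P : Prop :=
  P = A^T *m P *m A
      - A^T *m P *m B *m invmx (R + B^T *m P *m B) *m B^T *m P *m A + Q.

Definition dare_solution A B Q R P : Prop := sym_posdef P /\ dare A B Q R P.

(* The chosen symmetric positive definite solution; 0 if there is none. *)
Definition solve_dare A B Q R : 'M[K]_m := xget 0 (dare_solution A B Q R).

Definition optimal_feedback A B R P : 'M[K]_(r, m) :=
  - (invmx (R + B^T *m P *m B) *m B^T *m P *m A).

(* Kalman's rank condition on [B, A B, ..., A^(m-1) B]. *)
Definition controllable A B : Prop :=
  \rank (\mxrow_(k < m) ((A ^+ k) *m B)) = m.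

End LQR.

Definition block_diagonal {K : realType} {n : nat} (d : 'I_n -> nat)
    (M : 'M[K]_(\sum_i d i)) : Prop :=
  exists D : forall i, 'M[K]_(d i), M = \mxdiag_i D i.

Section Subsystems.
(* p i and q i are the input and state dimensions of subsystem i. *)
Context {K : realType} {n : nat} {p q : 'I_n -> nat}.
Local Notation r := (\sum_i p i)%N.
Local Notation m := (\sum_i q i)%N.
Variables (A : 'M[K]_m) (B : 'M[K]_(m, r)) (Q : 'M[K]_m) (R : 'M[K]_r).
Implicit Types (F : 'M[K]_(r, m)) (P : 'M[K]_m) (i j : 'I_n).

(* The i-th block column of the identity matrix. *)
Definition blk i : 'M[K]_(r, p i) := submxrow 1%:M i.

Definition coblk i : 'M[K]_r := 1%:M - blk i *m (blk i)^T.

Definition subA F i : 'M[K]_m := A + B *m coblk i *m F.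
Definition subB i : 'M[K]_(m, p i) := B *m blk i.
Definition subQ F i : 'M[K]_m :=
  Q + F^T *m coblk i *m R *m coblk i *m F.
Definition subR i : 'M[K]_(p i) := (blk i)^T *m R *m blk i.

(* The map g^i.  Its value Fnew is determined by (blk i)^T *m Fnew and
   coblk i *m Fnew, as blk i *m (blk i)^T + coblk i = 1%:M. *)
Definition block_update i F : 'M[K]_(r, m) :=
  let Pnew := solve_dare (subA F i) (subB i) (subQ F i) (subR i) in
  blk i *m optimal_feedback (subA F i) (subB i) (subR i) Pnew + coblk i *m F.

(* The subsystem updated in step k (counted from 0) when the cyclic sweep
   begins with j. *)
Definition sweep j (k : nat) : 'I_n := iter k (@ordS n) j.

Fixpoint split_iter j F (k : nat) : 'M[K]_(r, m) :=
  if k is k'.+1 then block_update (sweep j k') (split_iter j F k') else F.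

Definition full_cycle j F : 'M[K]_(r, m) := split_iter j F n.

Definition admissible_start j F : Prop := controllable (subA F j) (subB j).

(* The part of the derivative of g^i at the optimal feedback that lives in the
   i-th block row, the only one g^i changes. *)
Definition Dblock_row P i : 'M[K]_r :=
  - (blk i *m invmx (subR i + (subB i)^T *m P *m subB i)
       *m (subB i)^T *m P *m B *m coblk i).

(* g^i keeps the other block rows of its argument, so that coblk i *m g^i F =
   coblk i *m F contributes coblk i to the full derivative of g^i. *)
Definition Dblock_update P i : 'M[K]_r := coblk i + Dblock_row P i.

Definition Dcycle P j : 'M[K]_r :=
  \big[mulmx/1%:M]_(k <- rev (iota 0 n)) Dblock_update P (sweep j k).

End Subsystems.

Definition is_norm {K : realType} {V : lmodType K} (N : V -> K) : Prop :=
  [/\ forall x, 0 <= N x,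
      forall x, N x = 0 -> x = 0,
      forall a x, N (a *: x) = `|a| * N x
    & forall x y, N (x + y) <= N x + N y].

(* The norm of X |-> D *m X induced by N; every matrix norm compatible with N
   is at least as large. *)
Definition induced_norm {K : realType} {r m : nat} (N : 'M[K]_(r, m) -> K)
    (D : 'M[K]_r) : K :=
  sup [set N (D *m X) | X in [set X | N X <= 1]].

(* Only the iterates F^k with k in S are considered. *)
Definition local_linear_estimate {K : realType} {n : nat} {p q : 'I_n -> nat}
    (A : 'M[K]_(\sum_i q i)) (B : 'M[K]_(\sum_i q i, \sum_i p i))
    (Q : 'M[K]_(\sum_i q i)) (R : 'M[K]_(\sum_i p i)) (j : 'I_n)
    (Fopt : 'M[K]_(\sum_i p i, \sum_i q i))
    (N : 'M[K]_(\sum_i p i, \sum_i q i) -> K) (rho : K)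
    (S : pred nat) : Prop :=
  exists2 U, nbhs Fopt U
    & forall F0 k, admissible_start A B j F0 -> S k ->
        U (split_iter A B Q R j F0 k) ->
        N (split_iter A B Q R j F0 (k + n)%N - Fopt)
          <= rho * N (split_iter A B Q R j F0 k - Fopt).

(* Main.v *)
Require Import Defs.
From mathcomp Require Import all_boot all_order all_algebra.
From mathcomp Require Import all_classical all_reals all_analysis.
From mathcomp Require Import ring lra.
Set Implicit Arguments.
Unset Strict Implicit.
Unset Printing Implicit Defensive.
Import Order.TTheory GRing.Theory Num.Theory.
Import numFieldNormedType.Exports.
Local Open Scope classical_set_scope.
Local Open Scope ring_scope.

(** Write [S = R + B^T Popt B] and [E = F - Fopt].  Three facts carry the proof.

    - Second-order accuracy of the value.  The problem of subsystem [i] at [F]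
      is the full problem with the other inputs frozen at [F] (lemma
      [bellman_sub]; this is where [R] must be block diagonal).  Its value [Pnew]
      therefore lies between the unconstrained optimum [Popt] and the cost of
      using [F] itself.  Completing the square shows that one step of the latter
      exceeds [Popt] by the form of [E^T S E] only, whence
      [Popt <= Pnew <= (1 + c |E|^2) Popt] (lemma [sub_value_bracket]).  The two
      bounds also give the existence of [Pnew], by monotone value iteration
      between them, and uniqueness follows from monotonicity and subhomogeneity
      of the Riccati operator.

    - The derivative.  The new block row is an explicit function of [F] and
      [Pnew].  With [Popt] in place of [Pnew] it is affine in [F] and yields
      exactly [Fopt + Dblock_update E]; replacing [Popt] by [Pnew] costs
      [O(|E|^2)] (lemma [block_update_quadratic]).  Second-order contact of this
      kind composes, which gives the derivative of the whole cycle.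

    - Contraction.  [Dblock_update] equals
      [1 - Pi_i (Pi_i^T S Pi_i)^-1 Pi_i^T S], the [S]-orthogonal projection onto
      the kernel of [Pi_i^T S]: the linearized iteration is block Gauss-Seidel
      for [S].  A full cycle preserves the [S]-energy of [X] only if
      [Pi_i^T S X = 0] for all [i], that is only if [X = 0] (lemma
      [Dcycle_decrease]).  By compactness it contracts the energy norm with a
      rate below one, whichever subsystem comes first.

    For a norm [N] and any [rho] above the [N]-norm of the derivative of the
    cycle, the second-order remainder is absorbed by the gap near [Fopt] (lemma
    [quadratic_approx_rate]).  The energy norm gives a rate below one, from which
    the convergence of the iterates follows. *)

(** * Elementary limits and matrix identities *)

Section RealLimits.
Context {K : realType}.

Lemma le_geometric (a b c theta : K) : 0 <= theta < 1 ->
  (forall k, a <= b + c * theta ^+ k) -> a <= b.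
Proof.
move=> /andP[t0 t1] H; apply/ler_addgt0Pr => e e0.
have t1' : `|theta| < 1 by rewrite ger0_norm.
have /cvgrPdist_le/(_ e e0)[k _ Hk] := cvg_geometric c t1'.
have := Hk k (leqnn _); rewrite sub0r normrN /= => hk.
by apply: le_trans (H k) _; rewrite lerD2l; apply: le_trans hk; exact: ler_norm.
Qed.

Lemma le_eps (a b c : K) : 0 <= c -> (forall e, 0 < e -> a <= b + e * c) -> a <= b.
Proof.
move=> c0 H; apply/ler_addgt0Pr => e e0; have c1 : 0 < 1 + c by lra.
have : e / (1 + c) * (1 + c) = e by rewrite divfK// gt_eqF.
by have e' := divr_gt0 e0 c1; have := H _ e'; lra.
Qed.

End RealLimits.

Lemma addmxE (K : nmodType) a b (X Y : 'M[K]_(a, b)) i j :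
  (X + Y) i j = X i j + Y i j.
Proof. by rewrite mxE. Qed.

Lemma oppmxE (K : zmodType) a b (X : 'M[K]_(a, b)) i j : (- X) i j = - X i j.
Proof. by rewrite mxE. Qed.

(** Decides identities of sums of matrix monomials, entry by entry; products
    count as atoms and have to be expanded beforehand. *)
Ltac mx_abel := apply/matrixP => ? ?; rewrite ?(addmxE, oppmxE); ring.

Lemma tr_addmx (K : nmodType) a b (X Y : 'M[K]_(a, b)) : (X + Y)^T = X^T + Y^T.
Proof. by apply/matrixP => i j; rewrite !mxE. Qed.

Lemma tr_oppmx (K : zmodType) a b (X : 'M[K]_(a, b)) : (- X)^T = - X^T.
Proof. by apply/matrixP => i j; rewrite !mxE. Qed.

Lemma tr11E (K : nmodType) (X : 'M[K]_1) : X^T 0 0 = X 0 0.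
Proof. by rewrite mxE. Qed.

(** * Quadratic forms and positive definite matrices *)

Section QuadraticForms.
Context {K : realType}.

Definition qf k (M : 'M[K]_k) (x : 'cV[K]_k) : K := (x^T *m M *m x) 0 0.

Definition psd_le k (P W : 'M[K]_k) : Prop := forall x, qf P x <= qf W x.

Lemma qfD k (M N : 'M[K]_k) x : qf (M + N) x = qf M x + qf N x.
Proof. by rewrite /qf mulmxDr mulmxDl mxE. Qed.

Lemma qfN k (M : 'M[K]_k) x : qf (- M) x = - qf M x.
Proof. by rewrite /qf mulmxN mulNmx mxE. Qed.

Lemma qfZ k t (M : 'M[K]_k) x : qf (t *: M) x = t * qf M x.
Proof. by rewrite /qf -scalemxAr -scalemxAl mxE. Qed.

Lemma qfx0 k (M : 'M[K]_k) : qf M 0 = 0.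
Proof. by rewrite /qf mulmx0 mxE. Qed.

Lemma qf_mulmx k l (M : 'M[K]_k) (L : 'M[K]_(k, l)) x :
  qf M (L *m x) = qf (L^T *m M *m L) x.
Proof. by rewrite /qf trmx_mul !mulmxA. Qed.

Lemma qf_polar k (M : 'M[K]_k) x y : M^T = M ->
  qf M (x + y) = qf M x + qf M y + (x^T *m M *m y) 0 0 *+ 2.
Proof.
move=> sM; rewrite /qf.
have E : (y^T *m M *m x) 0 0 = (x^T *m M *m y) 0 0.
  by rewrite -[in LHS](trmxK (y^T *m M *m x)) mxE !trmx_mul trmxK sM mulmxA.
rewrite tr_addmx !(mulmxDl, mulmxDr) !addmxE E; ring.
Qed.

Lemma qf_delta k (M : 'M[K]_k) i : qf M (delta_mx i 0) = M i i.
Proof. by rewrite /qf trmx_delta -rowE -colE !mxE. Qed.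

Lemma sym_entry k (M : 'M[K]_k) i j : M^T = M ->
  M i j = (qf M (delta_mx i 0 + delta_mx j 0) - M i i - M j j) / 2.
Proof.
move=> sM; rewrite qf_polar// !qf_delta trmx_delta -rowE -colE !mxE; lra.
Qed.

Lemma posdef_ge0 k (M : 'M[K]_k) x : sym_posdef M -> 0 <= qf M x.
Proof.
move=> [_ pM]; have [->|x0] := eqVneq x 0; first by rewrite qfx0.
by rewrite ltW// pM.
Qed.

Lemma posdef_qf_eq0 k (M : 'M[K]_k) x : sym_posdef M -> qf M x = 0 -> x = 0.
Proof.
move=> [_ pM] q0; apply/eqP; apply: contraT => /pM.
by rewrite -/(qf M x) q0 ltxx.
Qed.

Lemma posdefD k (M N : 'M[K]_k) : sym_posdef M -> N^T = N ->
  (forall x, 0 <= qf N x) -> sym_posdef (M + N).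
Proof.
move=> [sM pM] sN pN; split; first by rewrite linearD /= sM sN.
by move=> x x0; rewrite -/(qf _ _) qfD ltr_wpDr// pM.
Qed.

Lemma posdef_ge k (M N : 'M[K]_k) : sym_posdef M -> N^T = N ->
  psd_le M N -> sym_posdef N.
Proof.
move=> [sM pM] sN MN; split => // x x0.
by apply: lt_le_trans (MN x); exact: pM.
Qed.

Lemma posdef_scale k t (M : 'M[K]_k) : 0 < t -> sym_posdef M -> sym_posdef (t *: M).
Proof.
move=> t0 [sM pM]; split; first by rewrite linearZ /= sM.
by move=> x x0; rewrite -/(qf _ _) qfZ mulr_gt0// pM.
Qed.

Lemma posdef_unit k (M : 'M[K]_k) : sym_posdef M -> M \in unitmx.
Proof.
move=> pM; rewrite -row_free_unit; apply: inj_row_free => v vM.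
apply: trmx_inj; rewrite trmx0; apply: posdef_qf_eq0 pM _.
by rewrite /qf trmxK vM mul0mx mxE.
Qed.

Lemma sym_invmx k (M : 'M[K]_k) : M^T = M -> (invmx M)^T = invmx M.
Proof. by move=> sM; rewrite trmx_inv sM. Qed.

Lemma posdef_inv k (M : 'M[K]_k) : sym_posdef M -> sym_posdef (invmx M).
Proof.
move=> pM; have uM := posdef_unit pM; have [sM p0] := pM.
split; first exact: sym_invmx.
move=> x x0; rewrite -/(qf _ _).
have -> : qf (invmx M) x = qf M (invmx M *m x).
  by rewrite qf_mulmx sym_invmx// mulVmx// mul1mx.
apply: p0; apply: contraNneq x0 => e.
by rewrite -(mulKVmx uM x) e mulmx0.
Qed.

Lemma qfNx k (M : 'M[K]_k) x : qf M (- x) = qf M x.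
Proof. by rewrite /qf tr_oppmx mulmxN !mulNmx opprK. Qed.

Lemma qfxZ k (M : 'M[K]_k) t x : qf M (t *: x) = t ^+ 2 * qf M x.
Proof.
by rewrite /qf [(t *: x)^T]linearZ /= -!scalemxAl -scalemxAr !mxE expr2 mulrA.
Qed.

(** Expand [0 <= qf M (M^-1 x - N^-1 x)]: up to the factor [- 2] the mixed
    term is [qf N^-1 x], which also bounds [qf M (N^-1 x)] because [M <= N]. *)
Lemma posdef_inv_le k (M N : 'M[K]_k) : sym_posdef M -> sym_posdef N ->
  psd_le M N -> psd_le (invmx N) (invmx M).
Proof.
move=> pM pN MN x; have uM := posdef_unit pM; have uN := posdef_unit pN.
have [[sM _] [sN _]] := (pM, pN).
pose y := invmx N *m x.
have eN : qf N y = qf (invmx N) x.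
  by rewrite qf_mulmx sym_invmx// mulVmx// mul1mx.
have eM : qf M (invmx M *m x) = qf (invmx M) x.
  by rewrite qf_mulmx sym_invmx// mulVmx// mul1mx.
have exy : ((invmx M *m x)^T *m M *m (- y)) 0 0 = - qf (invmx N) x.
  rewrite mulmxN mxE trmx_mul sym_invmx//; congr (- _).
  by rewrite /y /qf -!mulmxA mulKmx// mulmxA.
have := posdef_ge0 (invmx M *m x - y) pM.
rewrite qf_polar// exy eM qfNx.
have := MN y; rewrite eN; lra.
Qed.

End QuadraticForms.

(** * The Riccati operator and Bellman's equation *)

Section Riccati.
Context {K : realType} {m r : nat}.
Variables (A : 'M[K]_m) (B : 'M[K]_(m, r)) (Q : 'M[K]_m) (R : 'M[K]_r).
Hypotheses (Qpos : sym_posdef Q) (Rpos : sym_posdef R).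
Implicit Types (P : 'M[K]_m) (x : 'cV[K]_m) (u : 'cV[K]_r).

Definition riccati P : 'M[K]_m :=
  A^T *m P *m A
    - A^T *m P *m B *m invmx (R + B^T *m P *m B) *m B^T *m P *m A + Q.

(** The cost of applying the input [u] at the state [x] when the cost-to-go is
    the form of [P]. *)
Definition bellman P x u : K := qf P (A *m x + B *m u) + qf Q x + qf R u.

Definition input_weight P : 'M[K]_r := R + B^T *m P *m B.

Local Notation F_ := (optimal_feedback A B R).

Lemma input_weight_posdef P : sym_posdef P -> sym_posdef (input_weight P).
Proof.
move=> pP; have [sP _] := pP; apply: posdefD => //.
  by rewrite !trmx_mul trmxK sP mulmxA.
by move=> u; rewrite -qf_mulmx posdef_ge0.
Qed.

Lemma feedback_eq P : input_weight P \in unitmx ->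
  input_weight P *m F_ P = - (B^T *m P *m A).
Proof.
by move=> uS; rewrite /optimal_feedback -/(input_weight P) mulmxN -!mulmxA mulKVmx.
Qed.

Lemma riccati_sym P : P^T = P -> (riccati P)^T = riccati P.
Proof.
move=> sP; have [[sQ _] [sR _]] := (Qpos, Rpos).
have sS : (invmx (R + B^T *m P *m B))^T = invmx (R + B^T *m P *m B).
  by apply: sym_invmx; rewrite linearD /= !trmx_mul trmxK sP sR mulmxA.
rewrite /riccati !(tr_addmx, tr_oppmx) !trmx_mul !trmxK sP sQ sS.
by rewrite !mulmxA.
Qed.

(** Completion of the square in [u]: the Riccati operator is the minimum of the
    one-step cost, attained at the optimal feedback. *)
Lemma bellman_square P x u : sym_posdef P ->
  bellman P x u = qf (riccati P) x + qf (input_weight P) (u - F_ P *m x).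
Proof.
move=> pP; have [sP _] := pP; have pS := input_weight_posdef pP.
have uS := posdef_unit pS; have [sS _] := pS.
have fe := feedback_eq uS.
rewrite (qf_polar _ _ sS) /qf.
have -> : (u^T *m input_weight P *m - (F_ P *m x)) 0 0 =
   (u^T *m B^T *m P *m A *m x) 0 0.
  rewrite mulmxN -(mulmxA _ (input_weight P)) (mulmxA (input_weight P)) fe.
  by rewrite mulNmx mulmxN opprK !mulmxA.
rewrite -/(qf _ (- _)) qfNx /qf.
have -> : ((F_ P *m x)^T *m input_weight P *m (F_ P *m x)) 0 0
   = (x^T *m A^T *m P *m B *m invmx (R + B^T *m P *m B) *m B^T *m P *m A *m x) 0 0.
  rewrite -(mulmxA _ (input_weight P)) (mulmxA (input_weight P)) fe.
  rewrite /optimal_feedback -/(input_weight P) !mulNmx tr_oppmx.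
  rewrite mulmxN mulNmx opprK !trmx_mul trmxK sP sym_invmx//.
  by rewrite !mulmxA.
rewrite /input_weight /riccati /bellman /qf !tr_addmx !trmx_mul.
rewrite !(mulmxDr, mulmxDl, mulNmx, mulmxN, mulmxA) !(addmxE, oppmxE).
have -> : (x^T *m A^T *m P *m B *m u) 0 0 = (u^T *m B^T *m P *m A *m x) 0 0.
  by rewrite -[LHS]tr11E !trmx_mul !trmxK sP !mulmxA.
ring.
Qed.

End Riccati.

(** * Norms on matrices *)

Section MatrixNorm.
Context {K : realType}.

Lemma mx_entry_le_norm a b (X : 'M[K]_(a, b)) i j : `|X i j| <= `|X|.
Proof. by rewrite [leRHS]/Num.norm /= mx_normrE; exact: (le_bigmax _ _ (i, j)). Qed.

Lemma mx_norm_le a b (X : 'M[K]_(a, b)) (e : K) :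
  0 <= e -> (forall i j, `|X i j| <= e) -> `|X| <= e.
Proof.
move=> e0 Xe; rewrite [leLHS]/Num.norm /= mx_normrE.
by apply: bigmax_le => // -[i j] _; exact: Xe.
Qed.

Lemma mx_norm_mul a b c (X : 'M[K]_(a, b)) (Y : 'M[K]_(b, c)) :
  `|X *m Y| <= b%:R * `|X| * `|Y|.
Proof.
apply: mx_norm_le => [|i j]; first by rewrite !mulr_ge0.
rewrite mxE; apply: le_trans (ler_norm_sum _ _ _) _.
have -> : b%:R * `|X| * `|Y| = \sum_(k < b) `|X| * `|Y|.
  by rewrite sumr_const card_ord -[RHS]mulr_natl mulrA.
by apply: ler_sum => k _; rewrite normrM ler_pM// mx_entry_le_norm.
Qed.

Lemma mx_norm_mul_le a b c (X : 'M[K]_(a, b)) (Y : 'M[K]_(b, c)) x y :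
  `|X| <= x -> `|Y| <= y -> `|X *m Y| <= b%:R * x * y.
Proof.
move=> Xx Yy; apply: le_trans (mx_norm_mul _ _) _.
by rewrite ler_pM ?mulr_ge0// ler_wpM2l.
Qed.

Lemma mx_norm_tr a b (X : 'M[K]_(a, b)) : `|X^T| <= `|X|.
Proof. by apply: mx_norm_le => // i j; rewrite mxE mx_entry_le_norm. Qed.

Lemma mx_cvg T (F : set_system T) (FF : Filter F) a b
    (f : T -> 'M[K]_(a, b)) (l : 'M[K]_(a, b)) :
  (forall i j, f x i j @[x --> F] --> l i j) -> f @ F --> l.
Proof.
move=> fl; apply/cvgrPdist_le => e e0.
have : \forall x \near F, forall ij : 'I_a * 'I_b,
    `|l ij.1 ij.2 - f x ij.1 ij.2| <= e.
  by apply: filter_forall => -[i j] /=; have /cvgrPdist_le := fl i j; exact.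
apply: filterS => x Fx; apply: mx_norm_le => [|i j]; first exact: ltW.
by rewrite !mxE; exact: (Fx (i, j)).
Qed.

Lemma lipschitz_continuous_fun (V W : normedModType K) (f : V -> W) (C : K) :
  0 < C -> (forall x y, `|f x - f y| <= C * `|x - y|) -> continuous f.
Proof.
move=> C0 fL x; apply/(@cvgrPdist_le _ _ _ (nbhs x)) => e e0; near=> y.
apply: le_trans (fL _ _) _; rewrite -ler_pdivlMl// mulrC; near: y.
by apply: (@cvgr_dist_le _ _ _ (nbhs x) _ id); [exact: cvg_id | rewrite divr_gt0].
Unshelve. all: by end_near. Qed.

Lemma mulmx_continuous a b c (D : 'M[K]_(a, b)) :
  continuous (fun X : 'M[K]_(b, c) => D *m X).
Proof.
apply: (@lipschitz_continuous_fun _ _ _ (1 + b%:R * `|D|)) => [|X Y].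
  by rewrite ltr_wpDr// mulr_ge0.
rewrite -mulmxBr; apply: le_trans (mx_norm_mul _ _) _.
by rewrite ler_wpM2r// lerDr.
Qed.

(** The minimum of [f] over the compact unit sphere is positive, and
    homogeneity carries it to all of the space. *)
Lemma homogeneous_lower_bound a b (f : 'M[K]_(a, b) -> K) (C : K) :
  0 < C -> (forall X Y, `|f X - f Y| <= C * `|X - Y|) ->
  (forall t X, f (t *: X) = `|t| * f X) ->
  (forall X, X != 0 -> 0 < f X) ->
  exists2 d : K, 0 < d & forall X, d * `|X| <= f X.
Proof.
move=> C0 fL fZ fp.
have f0 : f 0 = 0 by rewrite -(scale0r 0) fZ normr0 mul0r.
pose S := [set v : 'rV[K]_(a * b) | `|v| = 1].
pose g (v : 'rV[K]_(a * b)) := f (vec_mx v).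
have vecL (X : 'M[K]_(a, b)) : `|X| <= `|mxvec X|.
  apply: mx_norm_le => // i j; rewrite -mxvecE; exact: mx_entry_le_norm.
have [[v Sv]|S0] := pselect (S !=set0); last first.
  exists 1 => // X; rewrite mul1r.
  have [->|X0] := eqVneq X 0; first by rewrite normr0 f0.
  case: S0; exists (`|mxvec X|^-1 *: mxvec X).
  by rewrite /S /= normrZ normfV normr_id mulVf// normr_eq0 mxvec_eq0.
have gL u w : `|g u - g w| <= C * `|u - w|.
  apply: le_trans (fL _ _) _; rewrite ler_pM2l// -linearB.
  by apply: le_trans (vecL _) _; rewrite vec_mxK.
have gcont : continuous g by exact: lipschitz_continuous_fun C0 gL.
have Scomp : compact S.
  apply: bounded_closed_compact.
    by exists 1; split => // M M1 u; rewrite /S /= => ->; exact: ltW.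
  apply: (@closed_comp _ _ (fun u : 'rV[K]_(a * b) => `|u|) [set 1]).
    by move=> u _; exact: norm_continuous.
  exact: closed_eq.
have [|c cS cmin] := EVT_min_rV _ Scomp (continuous_subspaceT gcont).
  by exists v.
exists (g c).
  move: cS; rewrite inE /S /= => c1; apply: fp.
  by rewrite vec_mx_eq0 -normr_eq0 c1 oner_eq0.
move=> X; have [->|X0] := eqVneq X 0; first by rewrite normr0 mulr0 f0.
have n0 : 0 < `|mxvec X| by rewrite normr_gt0 mxvec_eq0.
apply: (@le_trans _ _ (g c * `|mxvec X|)).
  rewrite ler_wpM2l//; move: cS; rewrite inE /S /= => c1; apply/ltW/fp.
  by rewrite vec_mx_eq0 -normr_eq0 c1 oner_eq0.
have := cmin (`|mxvec X|^-1 *: mxvec X); rewrite inE /S /= normrZ normfV.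
rewrite normr_id mulVf ?gt_eqF// => /(_ erefl).
by rewrite /g linearZ /= mxvecK fZ normfV normr_id ler_pdivlMl// mulrC.
Qed.

Lemma is_norm0 (V : lmodType K) (N : V -> K) : is_norm N -> N 0 = 0.
Proof. by move=> [_ _ NZ _]; rewrite -(scale0r 0) NZ normr0 mul0r. Qed.

Lemma is_normN (V : lmodType K) (N : V -> K) x : is_norm N -> N (- x) = N x.
Proof. by move=> [_ _ NZ _]; rewrite -scaleN1r NZ normrN1 mul1r. Qed.

Lemma is_norm_dist (V : lmodType K) (N : V -> K) x y : is_norm N ->
  `|N x - N y| <= N (x - y).
Proof.
move=> nN; have [_ _ _ ND] := nN.
have xy := ND (x - y) y; have yx := ND (y - x) x.
rewrite subrK in xy; rewrite subrK -opprB is_normN// in yx.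
by rewrite ler_norml; apply/andP; split; lra.
Qed.

Lemma is_norm_sum (V : lmodType K) (N : V -> K) (I : finType) (F : I -> V) :
  is_norm N -> N (\sum_i F i) <= \sum_i N (F i).
Proof.
move=> nN; have [_ _ _ ND] := nN.
elim/big_ind2 : _ => [|x a y b xa yb|//]; first by rewrite is_norm0.
by apply: le_trans (ND _ _) _; exact: lerD.
Qed.

Section NormEquivalence.
Variables (a b : nat) (N : 'M[K]_(a, b) -> K).
Hypothesis nN : is_norm N.

Lemma is_norm_le : exists2 C : K, 0 < C & forall X, N X <= C * `|X|.
Proof.
have [N0 _ NZ _] := nN.
exists (1 + \sum_i \sum_j N (delta_mx i j)).
  by rewrite ltr_wpDr//; do 2 apply: sumr_ge0 => ? _.
move=> X; rewrite {1}(matrix_sum_delta X).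
apply: le_trans (is_norm_sum _ nN) _.
rewrite mulrDl mul1r ler_wpDl// mulr_suml; apply: ler_sum => i _.
apply: le_trans (is_norm_sum _ nN) _.
rewrite mulr_suml; apply: ler_sum => j _.
by rewrite NZ mulrC ler_wpM2l// mx_entry_le_norm.
Qed.

Lemma is_norm_lipschitz : exists2 C : K, 0 < C &
  forall X Y, `|N X - N Y| <= C * `|X - Y|.
Proof.
have [C C0 NC] := is_norm_le; exists C => // X Y.
exact: le_trans (is_norm_dist _ _ nN) (NC _).
Qed.

(** Any norm is Lipschitz with respect to the entrywise one, so
    [homogeneous_lower_bound] applies to it. *)
Lemma is_norm_ge : exists2 C : K, 0 < C & forall X, `|X| <= C * N X.
Proof.
have [C C0 NL] := is_norm_lipschitz; have [N0 Neq NZ _] := nN.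
have [||d d0 dN] := homogeneous_lower_bound C0 NL; first exact: NZ.
  move=> X X0; rewrite lt_neqAle N0 andbT eq_sym.
  by apply: contra_neq X0 => /Neq.
by exists d^-1; [rewrite invr_gt0 | move=> X; rewrite ler_pdivlMl].
Qed.

(** Compactness makes the decrease uniform: apply [homogeneous_lower_bound] to
    [N X - N (D X)]. *)
Lemma strict_decrease_contraction (D : 'M[K]_a) :
  (forall X, X != 0 -> N (D *m X) < N X) ->
  exists2 rho : K, 0 < rho < 1 & forall X, N (D *m X) <= rho * N X.
Proof.
move=> Ddec; have [C C0 NL] := is_norm_lipschitz; have [N0 Neq NZ _] := nN.
have [C' C'0 NC'] := is_norm_le.
pose f X := N X - N (D *m X).
have d0 : 0 < 1 + a%:R * `|D| by rewrite ltr_wpDr// mulr_ge0.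
have [||||d dp df] := @homogeneous_lower_bound a b f (C + C * (1 + a%:R * `|D|)).
- by rewrite addr_gt0// mulr_gt0.
- move=> X Y; rewrite /f mulrDl.
  have -> : N X - N (D *m X) - (N Y - N (D *m Y)) =
    (N X - N Y) - (N (D *m X) - N (D *m Y)) by lra.
  apply: le_trans (ler_normB _ _) _; rewrite lerD//.
  apply: le_trans (NL _ _) _; rewrite -mulrA ler_pM2l// -mulmxBr.
  apply: le_trans (mx_norm_mul _ _) _.
  by rewrite ler_wpM2r// lerDr.
- by move=> t X; rewrite /f -scalemxAr !NZ mulrBr.
- by move=> X X0; rewrite /f subr_gt0 Ddec.
have dC : d / (d + C') < 1 by rewrite ltr_pdivrMr ?addr_gt0// mul1r ltrDl.
(* [N X] is at most [C' |X|]; the extra [d] makes the rate positive. *)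
exists (1 - d / (d + C')).
  by rewrite subr_gt0 dC gtrBl divr_gt0// addr_gt0.
move=> X; have := df X; rewrite /f => dfX.
have : d / (d + C') * N X <= d * `|X|.
  rewrite -mulrA ler_pM2l// mulrC ler_pdivrMr ?addr_gt0//.
  apply: le_trans (NC' X) _; rewrite mulrC ler_wpM2l// lerDr; exact: ltW.
by rewrite mulrBl mul1r; lra.
Qed.

End NormEquivalence.

End MatrixNorm.

(** * Comparison of forms with norms *)

Section Domination.
Context {K : realType}.

(** Cauchy-Schwarz for the form [P], applied to [x] and [P^-1 e_i]. *)
Lemma posdef_coord k (P : 'M[K]_k) (x : 'cV[K]_k) i : sym_posdef P ->
  (x i 0) ^+ 2 <= invmx P i i * qf P x.
Proof.
move=> pP; have uP := posdef_unit pP; have [sP _] := pP.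
pose e : 'cV[K]_k := delta_mx i 0.
have p0 : 0 < invmx P i i.
  rewrite -qf_delta; have [_] := posdef_inv pP; apply.
  by apply/eqP => /matrixP/(_ i 0)/eqP; rewrite !mxE !eqxx oner_eq0.
have q1 : qf P (invmx P *m e) = invmx P i i.
  by rewrite qf_mulmx sym_invmx// mulVmx// mul1mx qf_delta.
pose t := - (x i 0 / invmx P i i).
have := posdef_ge0 (x + t *: (invmx P *m e)) pP.
rewrite qf_polar//.
have -> : qf P (t *: (invmx P *m e)) = t ^+ 2 * invmx P i i.
  by rewrite -q1 qfxZ.
have -> : (x^T *m P *m (t *: (invmx P *m e))) 0 0 = t * x i 0.
  rewrite -scalemxAr mxE -mulmxA mulKVmx//.
  by rewrite /e -colE !mxE.
rewrite /t.
have -> : qf P x + (- (x i 0 / invmx P i i)) ^+ 2 * invmx P i i +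
   - (x i 0 / invmx P i i) * x i 0 *+ 2
   = qf P x - (x i 0) ^+ 2 / invmx P i i.
  by field; rewrite gt_eqF.
by rewrite subr_ge0 ler_pdivrMr// mulrC.
Qed.

(** All forms are comparable to a positive definite one, with a constant that is
    linear in the norm of the matrix. *)
Lemma posdef_dominates k (P : 'M[K]_k) : sym_posdef P ->
  exists2 c : K, 0 < c & forall M x, `|qf M x| <= c * `|M| * qf P x.
Proof.
move=> pP; pose t := \sum_i invmx P i i.
have Pi0 i : 0 <= invmx P i i.
  by rewrite -qf_delta posdef_ge0//; exact: posdef_inv.
exists (1 + (k * k)%:R * t).
  by rewrite ltr_wpDr// mulr_ge0// sumr_ge0.
move=> M x; have q0 := posdef_ge0 x pP.
have xt i : (x i 0) ^+ 2 <= t * qf P x.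
  apply: le_trans (posdef_coord _ _ pP) _; rewrite ler_wpM2r//.
  by rewrite /t (bigD1 i)//= lerDl sumr_ge0.
have xx i j : `|x i 0 * x j 0| <= t * qf P x.
  have := xt i; have := xt j; rewrite normrM -(real_normK (num_real (x i 0))).
  rewrite -(real_normK (num_real (x j 0))).
  have := sqr_ge0 (`|x i 0| - `|x j 0|); nra.
apply: (@le_trans _ _ (\sum_(i < k) \sum_(j < k) `|M| * (t * qf P x))).
  rewrite {1}/qf -mulmxA mxE; apply: le_trans (ler_norm_sum _ _ _) _.
  apply: ler_sum => i _; rewrite [x^T _ _]mxE [(M *m x) _ _]mxE mulr_sumr.
  apply: le_trans (ler_norm_sum _ _ _) _; apply: ler_sum => j _.
  have -> : x i 0 * (M i j * x j 0) = M i j * (x i 0 * x j 0) by ring.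
  by rewrite normrM; apply: ler_pM => //; exact: mx_entry_le_norm.
rewrite !sumr_const card_ord -mulrnA -[leLHS]mulr_natl.
have -> : (1 + (k * k)%:R * t) * `|M| * qf P x =
  `|M| * qf P x + (k * k)%:R * (`|M| * (t * qf P x)) by ring.
by rewrite lerDr mulr_ge0.
Qed.

Lemma sym_qf_inj k (M N : 'M[K]_k) : M^T = M -> N^T = N ->
  (forall x, qf M x = qf N x) -> M = N.
Proof.
move=> sM sN MN; apply/matrixP => i j.
by rewrite (sym_entry i j sM) (sym_entry i j sN) -!qf_delta !MN.
Qed.

(** By polarization the entries of a symmetric matrix are combinations of values
    of its form, so an order bound is a norm bound. *)
Lemma psd_norm_le k (W : 'M[K]_k) :
  exists2 c : K, 0 < c & forall (M : 'M[K]_k) t, M^T = M -> 0 <= t ->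
   (forall x, 0 <= qf M x <= t * qf W x) -> `|M| <= c * t.
Proof.
pose c := 1 + \sum_i \sum_j (`|qf W (delta_mx i 0 + delta_mx j 0)| + `|W i i| + `|W j j|).
exists c; first by rewrite ltr_wpDr//; do 2! apply: sumr_ge0 => ? _; rewrite !addr_ge0.
move=> N t sN t0 Nt; apply: mx_norm_le => [|i j].
  by rewrite mulr_ge0// addr_ge0//; do 2! apply: sumr_ge0 => ? _; rewrite !addr_ge0.
rewrite sym_entry// -!qf_delta.
pose s := `|qf W (delta_mx i 0 + delta_mx j 0)| + `|W i i| + `|W j j|.
have sc : s <= c.
  rewrite /c (bigD1 i)//= (bigD1 j)//= -/s.
  have : 0 <= \sum_(i0 < k | i0 != j)
         (`|qf W (delta_mx i 0 + delta_mx i0 0)| + `|W i i| + `|W i0 i0|).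
    by apply: sumr_ge0 => ? _; rewrite !addr_ge0.
  have : 0 <= \sum_(i0 < k | i0 != i) \sum_(j0 < k)
         (`|qf W (delta_mx i0 0 + delta_mx j0 0)| + `|W i0 i0| + `|W j0 j0|).
    by do 2! apply: sumr_ge0 => ? _; rewrite !addr_ge0.
  lra.
have bnd x : 0 <= qf N x <= t * `|qf W x|.
  have /andP[-> /=] := Nt x; move=> /le_trans; apply.
  by rewrite ler_wpM2l// ler_norm.
have /andP[a0 a1] := bnd (delta_mx i 0 + delta_mx j 0).
have /andP[b0 b1] := bnd (delta_mx i 0).
have /andP[c0 c1] := bnd (delta_mx j 0).
apply: (@le_trans _ _ (s * t)); last by rewrite ler_wpM2r.
rewrite /s -!qf_delta !mulrDl ler_norml; apply/andP.
move: (qf _ _) (qf _ _) (qf _ _) a0 a1 b0 b1 c0 c1 => u v w *.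
by split; lra.
Qed.

End Domination.

(** * Order properties of the Riccati operator; existence and uniqueness *)

Section RiccatiOrder.
Context {K : realType} {m r : nat}.
Variables (A : 'M[K]_m) (B : 'M[K]_(m, r)) (Q : 'M[K]_m) (R : 'M[K]_r).
Hypotheses (Qpos : sym_posdef Q) (Rpos : sym_posdef R).
Implicit Types (P : 'M[K]_m) (x : 'cV[K]_m) (u : 'cV[K]_r).

Local Notation F_ := (optimal_feedback A B R).
Local Notation ric := (riccati A B Q R).
Local Notation bell := (bellman A B Q R).

Lemma riccati_le_bellman P x u : sym_posdef P -> qf (ric P) x <= bell P x u.
Proof.
move=> pP; rewrite (bellman_square A B Q Rpos)// lerDl.
exact/posdef_ge0/input_weight_posdef.
Qed.

Lemma riccati_attained P x : sym_posdef P -> bell P x (F_ P *m x) = qf (ric P) x.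
Proof.
by move=> pP; rewrite (bellman_square A B Q Rpos)// subrr qfx0 addr0.
Qed.

(** Use the input that is optimal for the larger cost-to-go in both
    problems. *)
Lemma riccati_mono P W : sym_posdef P -> sym_posdef W -> psd_le P W ->
  psd_le (ric P) (ric W).
Proof.
move=> pP pW PW x; rewrite -(riccati_attained _ pW).
apply: le_trans (riccati_le_bellman _ (F_ W *m x) pP) _.
by rewrite /bellman !lerD2r.
Qed.

(** The one-step cost for [(1 + s) P] is [1 + s] times the one-step cost for [P]
    minus [s] times the stage cost, which is at least [qf Q x]. *)
Lemma riccati_scale P s x : sym_posdef P -> 0 <= s ->
  qf (ric ((1 + s) *: P)) x <= (1 + s) * qf (ric P) x - s * qf Q x.
Proof.
move=> pP s0; rewrite -(riccati_attained _ pP).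
have pP1 : sym_posdef ((1 + s) *: P) by apply: posdef_scale => //; lra.
apply: le_trans (riccati_le_bellman _ (F_ P *m x) pP1) _.
rewrite /bellman qfZ.
have := mulr_ge0 s0 (posdef_ge0 (F_ P *m x) Rpos); lra.
Qed.

Lemma riccati_ge_cost P : sym_posdef P -> psd_le Q (ric P).
Proof.
move=> pP x; rewrite -(riccati_attained _ pP) /bellman.
have := posdef_ge0 (F_ P *m x) Rpos.
have := posdef_ge0 (A *m x + B *m (F_ P *m x)) pP; lra.
Qed.

Lemma riccati_posdef P : sym_posdef P -> sym_posdef (ric P).
Proof.
move=> pP; apply: posdef_ge Qpos _ (riccati_ge_cost pP).
by have [sP _] := pP; exact: (riccati_sym A B Qpos Rpos sP).
Qed.

(** If [P1 <= (1 + s) P2], one application of the Riccati operator to both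
    sides improves the factor to [1 + theta s], where [1 - theta > 0] bounds from
    below the share of the cost-to-go [P2] that is paid in the current step. *)
Lemma dare_solution_le P1 P2 :
  dare_solution A B Q R P1 -> dare_solution A B Q R P2 -> psd_le P1 P2.
Proof.
move=> [p1 e1] [p2 e2].
have [c c0 Hc] := posdef_dominates Qpos.
have [d d0 Hd] := posdef_dominates p2.
pose C := 1 + c * `|P2|; pose theta := 1 - C^-1.
have C1 : 1 <= C by rewrite lerDl mulr_ge0// ltW.
have C0 : 0 < C by lra.
have PQ x : qf P2 x <= C * qf Q x.
  apply: le_trans (ler_norm _) _; apply: le_trans (Hc P2 x) _.
  by rewrite /C mulrDl mul1r lerDr posdef_ge0.
have th : 0 <= theta < 1.
  by rewrite /theta subr_ge0 invf_le1// C1 gtrBl invr_gt0.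
pose s := d * `|P1|.
have s0 : 0 <= s by rewrite mulr_ge0// ltW.
have step k x : qf P1 x <= (1 + s * theta ^+ k) * qf P2 x.
  elim: k x => [|k IH] x.
    rewrite expr0 mulr1 mulrDl mul1r; apply: le_trans (ler_norm _) _.
    by apply: le_trans (Hd P1 x) _; rewrite lerDr posdef_ge0.
  have sk : 0 <= s * theta ^+ k by rewrite mulr_ge0// exprn_ge0; case/andP: th.
  have p2' : sym_posdef ((1 + s * theta ^+ k) *: P2).
    by apply: posdef_scale => //; lra.
  have le1 : psd_le P1 ((1 + s * theta ^+ k) *: P2) by move=> y; rewrite qfZ.
  rewrite {1}e1; apply: le_trans (riccati_mono p1 p2' le1 x) _.
  apply: le_trans (riccati_scale x p2 sk) _.
  rewrite {1}/riccati -[X in qf X x]e2.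
  have : C^-1 * qf P2 x <= qf Q x by rewrite ler_pdivrMl.
  move=> /(ler_wpM2l sk); rewrite exprSr /theta; lra.
move=> x; apply: (le_geometric (c := s * qf P2 x) th) => k.
by have := step k x; lra.
Qed.

Lemma dare_solution_unique P1 P2 :
  dare_solution A B Q R P1 -> dare_solution A B Q R P2 -> P1 = P2.
Proof.
move=> s1 s2; have [[[e1 _] _] [[e2 _] _]] := (s1, s2).
by apply: sym_qf_inj => // x; apply/eqP; rewrite eq_le !dare_solution_le.
Qed.

(** Value iteration from a subsolution increases and stays below any
    supersolution, hence converges.  Its limit [P] satisfies
    [P_k <= P <= (1 + e) P_k] for large [k], and by monotonicity and
    subhomogeneity the Riccati operator maps [P] into the interval from
    [P_(k + 1)] to [(1 + e) P_(k + 1)]; this takes the place of the continuity of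
    the matrix inverse. *)
Lemma dare_solution_exists P0 W : sym_posdef P0 -> sym_posdef W ->
  psd_le P0 W -> psd_le P0 (ric P0) -> psd_le (ric W) W ->
  exists P, [/\ dare_solution A B Q R P, psd_le P0 P & psd_le P W].
Proof.
move=> p0 pW P0W sub sup; pose P_ k := iter k ric P0.
have pP k : sym_posdef (P_ k) by elim: k => //= k; exact: riccati_posdef.
have inc k : psd_le (P_ k) (P_ k.+1).
  by elim: k => //= k IH; exact: riccati_mono (pP k) (pP k.+1) IH.
have mon k l : (k <= l)%N -> psd_le (P_ k) (P_ l).
  move=> /subnK <-; elim: (l - k)%N => [|d IH] x //.
  exact: le_trans (IH x) (inc _ x).
have bnd k : psd_le (P_ k) W.
  elim: k => //= k IH x; apply: le_trans (sup x).
  exact: riccati_mono (pP k) pW IH x.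
have qcvg x : cvgn (fun k => qf (P_ k) x).
  apply: nondecreasing_is_cvgn; first by move=> k l kl; exact: mon.
  by exists (qf W x) => _ [k _ <-]; exact: bnd.
pose P := \matrix_(i, j) limn (fun k => P_ k i j) : 'M[K]_m.
have ecvg i j : P_ k i j @[k --> \oo] --> P i j.
  rewrite mxE; suff : cvgn (fun k => P_ k i j) by [].
  rewrite (_ : (fun k => P_ k i j) = fun k => (qf (P_ k) (delta_mx i 0 + delta_mx j 0)
      - qf (P_ k) (delta_mx i 0) - qf (P_ k) (delta_mx j 0)) / 2); last first.
    by apply/funext => k; rewrite sym_entry ?qf_delta//; case: (pP k).
  by apply: is_cvgMr_tmp; apply: is_cvgB; [apply: is_cvgB|]; exact: qcvg.
have Pcvg : P_ k @[k --> \oo] --> P by exact: mx_cvg.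
have [c c0 Hc] := posdef_dominates p0.
have close e : 0 < e ->
    exists k, forall l x, (k <= l)%N -> `|qf P x - qf (P_ l) x| <= e * qf P0 x.
  move=> e0; have ec : 0 < e / c by rewrite divr_gt0.
  have /cvgrPdist_le/(_ _ ec)[k _ Hk] := Pcvg.
  exists k => l x kl; have := Hk l kl => /= hk.
  rewrite -qfN -qfD; apply: le_trans (Hc _ x) _.
  by rewrite ler_wpM2r ?posdef_ge0// -ler_pdivlMl// mulrC.
have PkP k : psd_le (P_ k) P.
  move=> x; apply: (le_eps (posdef_ge0 x p0)) => e e0.
  have [l Hl] := close e e0.
  have := Hl (maxn k l) x (leq_maxr _ _); rewrite ler_norml => /andP[h _].
  by have := mon k (maxn k l) (leq_maxl _ _) x; lra.
have PW : psd_le P W.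
  move=> x; apply: (le_eps (posdef_ge0 x p0)) => e e0.
  have [l Hl] := close e e0.
  have := Hl l x (leqnn _); rewrite ler_norml => /andP[_ h].
  by have := bnd l x; lra.
have sP : P^T = P.
  apply/matrixP => i j; rewrite !mxE; congr (limn _); apply/funext => k.
  by have [<- _] := pP k; rewrite mxE; have [-> _] := pP k.
have pPl : sym_posdef P by exact: posdef_ge p0 sP (PkP 0%N).
exists P; split=> //; last exact: (PkP 0%N).
split=> //; apply: sym_qf_inj => //.
  exact: (riccati_sym A B Qpos Rpos sP).
move=> x; apply/eqP; rewrite eq_le; apply/andP; split.
  apply: (le_eps (posdef_ge0 x p0)) => e e0.
  have [l Hl] := close e e0.
  have := Hl l x (leqnn _); rewrite ler_norml => /andP[_ h].
  have := inc l x; have := riccati_mono (pP l) pPl (PkP l) x.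
  by rewrite -/(riccati A B Q R P) /P_ /=; lra.
apply: (le_eps (posdef_ge0 x pPl)) => e e0.
have [l Hl] := close e e0.
have le1 : psd_le P ((1 + e) *: P_ l).
  move=> y; have := Hl l y (leqnn _); rewrite ler_norml qfZ => /andP[_ h].
  have := mon 0%N l (leq0n _) y => /= /(ler_wpM2l (ltW e0)); lra.
have e1 : 0 < 1 + e by lra.
apply: le_trans (riccati_mono pPl (posdef_scale e1 (pP l)) le1 x) _.
apply: le_trans (riccati_scale x (pP l) (ltW e0)) _.
have := mulr_ge0 (ltW e0) (posdef_ge0 x Qpos).
by have := PkP l.+1 x => /(ler_wpM2l (ltW e1)) /=; rewrite /P_ /=; lra.
Qed.

End RiccatiOrder.

(** * Block rows of the input *)

Section Blocks.
Context {K : realType} {n : nat} {p : 'I_n -> nat}.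
Local Notation r := (\sum_i p i)%N.
Local Notation Pi := (@blk K n p).
Local Notation coPi := (@coblk K n p).

Lemma tr_blk i : (Pi i)^T = submxcol 1%:M i.
Proof. by rewrite /blk tr_submxrow trmx1. Qed.

Lemma tr_blk_mul a (X : 'M[K]_(r, a)) i : (Pi i)^T *m X = submxcol X i.
Proof. by rewrite tr_blk submxcol_mul mul1mx. Qed.

Lemma tr_blk_inj a (X Y : 'M[K]_(r, a)) :
  (forall i, (Pi i)^T *m X = (Pi i)^T *m Y) -> X = Y.
Proof. by move=> XY; apply/mxcolP => i; rewrite -!tr_blk_mul XY. Qed.

Lemma blk_orth i : (Pi i)^T *m Pi i = 1%:M.
Proof.
rewrite /blk mul_submxrow mulmx1 -/(blk i) tr_blk -submxblockEv.
by rewrite -mxdiagZ /mxdiag mxblockK eqxx conform_mx_id.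
Qed.

Lemma coblk_sym i : (coPi i)^T = coPi i.
Proof. by rewrite /coblk linearB /= trmx1 trmx_mul trmxK. Qed.

Lemma blk_split a (X : 'M[K]_(r, a)) i :
  Pi i *m ((Pi i)^T *m X) + coPi i *m X = X.
Proof. by rewrite /coblk mulmxBl mul1mx mulmxA addrC subrK. Qed.

(** [Pi_i^T R = D_i Pi_i^T] for the diagonal block [D_i], and [coblk i]
    annihilates [Pi_i]. *)
Lemma block_diagonal_cross (R : 'M[K]_r) i : block_diagonal R ->
  (Pi i)^T *m R *m coPi i = 0.
Proof.
move=> [D ->]; have -> : (Pi i)^T *m (\mxdiag_i D i) = D i *m (Pi i)^T.
  rewrite -[X in _ *m X]mulmx1 -[1%:M]submxcolK mul_mxdiag_mxcol tr_blk_mul.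
  by rewrite mxcolK tr_blk.
rewrite -mulmxA /coblk mulmxBr mulmx1 [(Pi i)^T *m _]mulmxA blk_orth mul1mx.
by rewrite subrr mulmx0.
Qed.

End Blocks.

(** * The problem of a single subsystem *)

(** The feedback of a subsystem is affine in [F] when the cost-to-go is kept
    fixed; the right-hand side expands it around [G]. *)
Lemma affine_update (K : realType) (r p m : nat) (X : 'M[K]_(r, p)) V
    (W : 'M[K]_(p, m)) (P A : 'M[K]_m) (B : 'M[K]_(m, r)) C (F G : 'M[K]_(r, m)) :
  X *m - (V *m W *m P *m (A + B *m C *m F)) + C *m F =
  X *m - (V *m W *m P *m (A + B *m C *m G)) + C *m G +
  (C - X *m V *m W *m P *m B *m C) *m (F - G).
Proof.
rewrite !(mulmxBl, mulmxBr, mulmxDl, mulmxDr, mulNmx, mulmxN, mulmxA).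
mx_abel.
Qed.

Section Subproblem.
Context {K : realType} {n : nat} {p q : 'I_n -> nat}.
Local Notation r := (\sum_i p i)%N.
Local Notation m := (\sum_i q i)%N.
Variables (A : 'M[K]_m) (B : 'M[K]_(m, r)) (Q : 'M[K]_m) (R : 'M[K]_r).
Hypotheses (Qpos : sym_posdef Q) (Rpos : sym_posdef R) (Rdiag : block_diagonal R).
Implicit Types (F : 'M[K]_(r, m)) (P : 'M[K]_m) (i : 'I_n).
Local Notation Pi := (@blk K n p).
Local Notation coPi := (@coblk K n p).

Definition sub_riccati F i :=
  riccati (subA A B F i) (subB B i) (subQ Q R F i) (subR R i).

Definition sub_feedback F i P : 'M[K]_(p i, m) :=
  optimal_feedback (subA A B F i) (subB B i) (subR R i) P.

Lemma qf_subR i v : qf (subR R i) v = qf R (Pi i *m v).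
Proof. by rewrite qf_mulmx. Qed.

Lemma subR_posdef i : sym_posdef (subR R i).
Proof.
have [sR pR] := Rpos; split; first by rewrite /subR !trmx_mul trmxK sR mulmxA.
move=> v v0; rewrite -/(qf _ _) qf_subR; apply: pR.
by apply: contraNneq v0 => e; rewrite -(mul1mx v) -(blk_orth i) -mulmxA e mulmx0.
Qed.

Lemma qf_subQ F i x : qf (subQ Q R F i) x = qf Q x + qf R (coPi i *m F *m x).
Proof. by rewrite /subQ qfD qf_mulmx trmx_mul coblk_sym !mulmxA. Qed.

Lemma subQ_ge F i : psd_le Q (subQ Q R F i).
Proof. by move=> x; rewrite qf_subQ lerDl posdef_ge0. Qed.

Lemma subQ_posdef F i : sym_posdef (subQ Q R F i).
Proof.
have [[sQ _] [sR _]] := (Qpos, Rpos).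
apply: posdef_ge Qpos _ (subQ_ge F i).
by rewrite /subQ linearD /= !trmx_mul trmxK coblk_sym sQ sR !mulmxA.
Qed.

(** The problem of subsystem [i] is the full problem with the inputs of the
    other subsystems prescribed by [F]; the input cost splits because [R] has no
    cross terms. *)
Lemma bellman_sub F i P x v :
  bellman (subA A B F i) (subB B i) (subQ Q R F i) (subR R i) P x v =
  bellman A B Q R P x (Pi i *m v + coPi i *m F *m x).
Proof.
have [sR _] := Rpos.
rewrite /bellman qf_subQ qf_subR (qf_polar _ _ sR).
have -> : ((Pi i *m v)^T *m R *m (coPi i *m F *m x)) 0 0 = 0.
  rewrite trmx_mul !mulmxA -(mulmxA v^T) -(mulmxA v^T) block_diagonal_cross//.
  by rewrite mulmx0 !mul0mx mxE.
have -> : subA A B F i *m x + subB B i *m v =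
   A *m x + B *m (Pi i *m v + coPi i *m F *m x).
  by rewrite /subA /subB mulmxDl mulmxDr !mulmxA addrA addrAC.
ring.
Qed.

(** The subsystem minimizes over fewer inputs than the full problem. *)
Lemma sub_riccati_ge F i P : sym_posdef P ->
  psd_le (riccati A B Q R P) (sub_riccati F i P).
Proof.
move=> pP x; have := riccati_attained (subA A B F i) (subB B i) (subQ Q R F i)
  (subR_posdef i) x pP.
by rewrite /sub_riccati => <-; rewrite bellman_sub riccati_le_bellman.
Qed.

(** The input [F x] is available to the subsystem. *)
Lemma sub_riccati_le F i P x : sym_posdef P ->
  qf (sub_riccati F i P) x <= bellman A B Q R P x (F *m x).
Proof.
move=> pP; have pR := subR_posdef i.
apply: le_trans (riccati_le_bellman (subA A B F i) (subB B i) (subQ Q R F i) pR x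
  ((Pi i)^T *m (F *m x)) pP) _.
by rewrite bellman_sub -mulmxA blk_split.
Qed.

Variable Popt : 'M[K]_m.
Hypothesis Psol : dare_solution A B Q R Popt.
Local Notation Fopt := (optimal_feedback A B R Popt).
Local Notation S := (input_weight B R Popt).
Local Notation Pnew F i :=
  (solve_dare (subA A B F i) (subB B i) (subQ Q R F i) (subR R i)).

Let Ppos : sym_posdef Popt := Psol.1.

(** [Fopt] minimizes the one-step cost, so the excess is quadratic. *)
Lemma bellman_opt F x :
  bellman A B Q R Popt x (F *m x) = qf Popt x + qf S ((F - Fopt) *m x).
Proof.
rewrite (bellman_square A B Q Rpos)//.
by rewrite [riccati _ _ _ _ _](esym Psol.2) mulmxBl.
Qed.

Lemma qf_deviation : exists2 k : K, 0 < k &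
  forall (E : 'M[K]_(r, m)) x, qf S (E *m x) <= k * `|E| ^+ 2 * qf Q x.
Proof.
have [d d0 Hd] := posdef_dominates Qpos.
exists (1 + d * (r%:R * (r%:R * `|S|))).
  by rewrite ltr_wpDr// !mulr_ge0// ltW.
move=> E x; rewrite qf_mulmx; apply: le_trans (ler_norm _) _.
apply: le_trans (Hd _ x) _; rewrite ler_wpM2r ?posdef_ge0//.
have h : `|E^T *m S *m E| <= r%:R * (r%:R * `|S|) * `|E| ^+ 2.
  apply: le_trans (mx_norm_mul _ _) _.
  have -> : r%:R * (r%:R * `|S|) * `|E| ^+ 2 = r%:R * (r%:R * `|E| * `|S|) * `|E| by ring.
  rewrite ler_wpM2r// ler_wpM2l//; apply: le_trans (mx_norm_mul _ _) _.
  by rewrite ler_wpM2r// ler_wpM2l// mx_norm_tr.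
have := ler_wpM2l (ltW d0) h; have := sqr_ge0 `|E|; lra.
Qed.

(** [Popt] is a subsolution of the Riccati equation of the subsystem, by
    [sub_riccati_ge].  The excess in [bellman_opt] is at most
    [k |F - Fopt|^2] times the stage cost, and scaling [Popt] by [1 + eps] gains
    [eps] times the stage cost, so [(1 + eps) Popt] is a supersolution for [eps]
    of order [|F - Fopt|^2]. *)
Lemma sub_value_bracket : exists2 c : K, 0 < c & exists2 d : K, 0 < d <= 1 &
  forall F i, `|F - Fopt| <= d ->
  [/\ dare_solution (subA A B F i) (subB B i) (subQ Q R F i) (subR R i) (Pnew F i),
      psd_le Popt (Pnew F i)
    & psd_le (Pnew F i) ((1 + c * `|F - Fopt| ^+ 2) *: Popt)].
Proof.
have [k k0 Hk] := qf_deviation.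
exists (2 * k); first by rewrite mulr_gt0.
have k1 : 0 < 1 + 2 * k by lra.
exists (1 + 2 * k)^-1.
  by rewrite invr_gt0 k1 invf_le1//; lra.
move=> F i Fd; set h := `|F - Fopt| in Fd *.
have h0 : 0 <= h by exact: normr_ge0.
have kh : (1 + 2 * k) * h <= 1 by rewrite -ler_pdivlMl// mulr1.
have kh2 : 2 * k * h ^+ 2 <= 1.
  have h1 : h <= 1 by have := mulr_ge0 (ltW k0) h0; lra.
  by have := mulr_ge0 (ltW k0) h0; nra.
(* The factor 2 leaves room for [(1 + eps) k h^2 <= eps], as [eps <= 1]. *)
set eps := 2 * k * h ^+ 2 in kh2 *.
have eps0 : 0 <= eps by rewrite /eps !mulr_ge0 ?exprn_ge0// ltW.
have e1 : 0 < 1 + eps by lra.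
have pQ := subQ_posdef F i; have pR := subR_posdef i.
have [|||||P [sol loP hiP]] := dare_solution_exists pQ pR
    (A := subA A B F i) (B := subB B i) (P0 := Popt) (W := (1 + eps) *: Popt) => //.
- exact: posdef_scale.
- by move=> x; rewrite qfZ; have := mulr_ge0 eps0 (posdef_ge0 x Ppos); lra.
- by move=> x; rewrite {1}Psol.2; exact: sub_riccati_ge.
- move=> x; rewrite qfZ.
  apply: le_trans (riccati_scale (subA A B F i) (subB B i) (subQ Q R F i) pR x Ppos eps0) _.
  have := sub_riccati_le F i x Ppos; rewrite bellman_opt => le1.
  have := Hk (F - Fopt) x; rewrite -/h => le2.
  have := ler_wpM2l eps0 (subQ_ge F i x).
  have le3 : qf (sub_riccati F i Popt) x <= qf Popt x + k * h ^+ 2 * qf Q x by lra.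
  have := ler_wpM2l (ltW e1) le3; rewrite /sub_riccati.
  have := posdef_ge0 x Qpos => q0.
  have : (1 + eps) * (k * h ^+ 2 * qf Q x) <= eps * qf Q x.
    have -> : (1 + eps) * (k * h ^+ 2 * qf Q x) = (1 + eps) * (eps / 2) * qf Q x.
      by rewrite /eps; field.
    by rewrite ler_wpM2r//; nra.
  lra.
have solP : dare_solution (subA A B F i) (subB B i) (subQ Q R F i) (subR R i) (Pnew F i).
  by rewrite /solve_dare; apply: (xgetPex 0); exists P.
by have <- : P = Pnew F i by exact: dare_solution_unique sol solP.
Qed.

Lemma sub_weight i : input_weight (subB B i) (subR R i) Popt = (Pi i)^T *m S *m Pi i.
Proof.
by rewrite /input_weight /subB /subR mulmxDr mulmxDl trmx_mul !mulmxA.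
Qed.

Lemma sub_weight_posdef i P : sym_posdef P ->
  sym_posdef (input_weight (subB B i) (subR R i) P).
Proof. exact/input_weight_posdef/subR_posdef. Qed.

Lemma weight_cross i :
  (Pi i)^T *m S *m coPi i = (Pi i)^T *m (B^T *m Popt *m B) *m coPi i.
Proof.
by rewrite /input_weight (mulmxDr (Pi i)^T) mulmxDl block_diagonal_cross// add0r.
Qed.

(** Multiply the optimality equation [S Fopt = - B^T Popt A] by [Pi_i^T]: the
    contribution of the other block rows of [Fopt] is the feedback term of
    [subA]. *)
Lemma sub_feedback_opt i : sub_feedback Fopt i Popt = (Pi i)^T *m Fopt.
Proof.
have uS := posdef_unit (sub_weight_posdef i Ppos).
apply: (can_inj (mulKmx uS)); rewrite feedback_eq// sub_weight.
have fe := feedback_eq A (posdef_unit (input_weight_posdef B Rpos Ppos)).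
have split_ (T : 'M[K]_r) (X : 'M[K]_(r, m)) : (Pi i)^T *m T *m Pi i *m ((Pi i)^T *m X) =
    (Pi i)^T *m (T *m X) - (Pi i)^T *m T *m coPi i *m X.
  by rewrite -[in X in X - _](blk_split X i) (mulmxDr T) (mulmxDr (Pi i)^T) !mulmxA addrK.
rewrite split_ fe weight_cross /subA /subB (mulmxN (Pi i)^T) trmx_mul.
by rewrite (mulmxDr _ A) opprD !mulmxA.
Qed.

(** This is why the derivative contains [Popt] but no derivative of the value:
    frozen at [Popt], the update is affine in [F]. *)
Lemma linear_update F i :
  Pi i *m sub_feedback F i Popt + coPi i *m F =
  Fopt + Dblock_update B R Popt i *m (F - Fopt).
Proof.
rewrite -[in X in _ = X + _](blk_split Fopt i) -sub_feedback_opt.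
move: (optimal_feedback A B R Popt) => G.
rewrite /Dblock_update /Dblock_row /sub_feedback /optimal_feedback /subA.
exact: affine_update.
Qed.

(** Replacing [Popt] by the value of the subsystem changes the update by a
    multiple of [Pnew F i - Popt], a quantity of second order. *)
Lemma block_update_remainder F i : sym_posdef (Pnew F i) ->
  block_update A B Q R i F - (Fopt + Dblock_update B R Popt i *m (F - Fopt)) =
  - (Pi i *m invmx (input_weight (subB B i) (subR R i) (Pnew F i)) *m (subB B i)^T
     *m (Pnew F i - Popt) *m
     (A + B *m (Fopt + Dblock_update B R Popt i *m (F - Fopt)))).
Proof.
move=> pP; rewrite -linear_update /block_update -/(sub_feedback F i (Pnew F i)).
set P := Pnew F i in pP *; pose W := input_weight (subB B i) (subR R i) P.
pose W0 := input_weight (subB B i) (subR R i) Popt.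
have uW : W \in unitmx by exact: posdef_unit (sub_weight_posdef i pP).
have uW0 : W0 \in unitmx by exact: posdef_unit (sub_weight_posdef i Ppos).
have fW : W *m sub_feedback F i P = - ((subB B i)^T *m P *m subA A B F i).
  exact: feedback_eq.
have fW0 : W0 *m sub_feedback F i Popt = - ((subB B i)^T *m Popt *m subA A B F i).
  exact: feedback_eq.
have dW : W = W0 + (subB B i)^T *m (P - Popt) *m subB B i.
  rewrite /W /W0 /input_weight mulmxBr mulmxBl.
  by rewrite -addrA; congr (_ + _); rewrite [RHS]addrC subrK.
have -> : A + B *m (Pi i *m sub_feedback F i Popt + coPi i *m F) =
  subA A B F i + subB B i *m sub_feedback F i Popt.
  by rewrite /subA /subB (mulmxDr B) !mulmxA addrA addrAC.
rewrite -/W; clearbody W W0 P.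
move: (sub_feedback F i P) (sub_feedback F i Popt) (subA _ _ _ _) (subB _ _) fW fW0 dW.
move=> G G0 A' B' fW fW0 dW.
rewrite opprD addrACA subrr addr0 -mulmxBr -!mulmxA -mulmxN; congr (_ *m _).
apply: (can_inj (mulKmx uW)); rewrite mulmxN mulKVmx// mulmxBr fW {1}dW mulmxDl fW0.
rewrite !mulmxDr !mulmxA !(mulmxDl, mulmxDr, mulNmx, mulmxN, mulmxA).
mx_abel.
Qed.

End Subproblem.

(** * Second-order contact with an affine map *)

Lemma quadratic_contact_diff (K : realType) (V W : normedModType K) (f : V -> W)
    (df : {linear V -> W}) (x : V) (C d : K) : 0 < C -> 0 < d -> continuous df ->
  (forall y, `|y - x| <= d -> `|f y - f x - df (y - x)| <= C * `|y - x| ^+ 2) ->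
  differentiable f x /\ 'd f x = df :> (V -> W).
Proof.
move=> C0 d0 cD H.
have lD : f \o shift x = cst (f x) + df +o_ 0 id.
  apply/eqaddoP => e e0; near=> y.
  have yd : `|y| <= d by near: y; exact: nbhs0_le.
  have := H (y + x); rewrite addrK => /(_ yd).
  rewrite /= !fctE opprD addrA /= => /le_trans; apply.
  rewrite expr2 mulrA ler_wpM2r//.
  rewrite -ler_pdivlMl// mulrC; near: y; apply: nbhs0_le; exact: divr_gt0.
have dE := diff_unique cD lD.
by split=> //; apply/diff_locallyP; rewrite dE.
Unshelve. all: by end_near. Qed.

Section QuadraticApproximation.
Context {K : realType} {r m : nat}.
Implicit Types (f g : 'M[K]_(r, m) -> 'M[K]_(r, m)) (D : 'M[K]_r).

Variable Fo : 'M[K]_(r, m).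

(** Second-order contact at the fixed point [Fo] with [F |-> Fo + D (F - Fo)].
    It implies that [D] is the derivative and, unlike differentiability,
    composes by elementary estimates that also serve for the rate. *)
Definition quadratic_approx f D : Prop :=
  exists2 C : K, 0 < C & exists2 d : K, 0 < d & forall F, `|F - Fo| <= d ->
    `|f F - (Fo + D *m (F - Fo))| <= C * `|F - Fo| ^+ 2.

Lemma quadratic_approx_fixed f D : quadratic_approx f D -> f Fo = Fo.
Proof.
move=> [C C0 [d d0 H]]; have := H Fo; rewrite subrr normr0 => /(_ (ltW d0)).
by rewrite mulmx0 addr0 expr0n /= mulr0 normr_le0 subr_eq0 => /eqP.
Qed.

Lemma quadratic_approx_lipschitz f D : quadratic_approx f D ->
  exists2 L : K, 0 < L & exists2 d : K, 0 < d & forall F, `|F - Fo| <= d ->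
    `|f F - Fo| <= L * `|F - Fo|.
Proof.
move=> [C C0 [d d0 H]]; exists (r%:R * `|D| + C * d).
  by rewrite ltr_wpDl ?mulr_ge0// mulr_gt0.
exists d => // F Fd; have -> : f F - Fo =
    (f F - (Fo + D *m (F - Fo))) + D *m (F - Fo) by rewrite opprD addrA subrK.
apply: le_trans (ler_normD _ _) _; rewrite mulrDl addrC lerD ?mx_norm_mul//.
apply: le_trans (H _ Fd) _; rewrite expr2 mulrA ler_wpM2r// ler_pM2l//.
Qed.

Lemma quadratic_approx_id : quadratic_approx id 1%:M.
Proof.
exists 1 => //; exists 1 => // F _.
by rewrite mul1mx [Fo + _]addrC subrK subrr normr0 mul1r exprn_ge0.
Qed.

Lemma quadratic_approx_comp f g D E : quadratic_approx f D ->
  quadratic_approx g E -> quadratic_approx (g \o f) (E *m D).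
Proof.
move=> qf qg; have [L L0 [dL dL0 HL]] := quadratic_approx_lipschitz qf.
move: qf qg => [C C0 [d d0 Hf]] [C' C'0 [d' d'0 Hg]].
exists (C' * L ^+ 2 + r%:R * `|E| * C).
  by rewrite ltr_wpDr ?mulr_ge0// ?mulr_gt0 ?exprn_gt0// ltW.
exists (Num.min (Num.min dL d) (d' / L)).
  by rewrite !lt_min dL0 d0 divr_gt0.
move=> F; rewrite !le_min => /andP[/andP[FL Fd] Fd'] /=.
have fL := HL F FL; have fd : `|f F - Fo| <= d'.
  by apply: le_trans fL _; rewrite mulrC -ler_pdivlMr.
have -> : g (f F) - (Fo + E *m D *m (F - Fo)) =
    (g (f F) - (Fo + E *m (f F - Fo))) + E *m (f F - (Fo + D *m (F - Fo))).
  rewrite [- (Fo + D *m _)]opprD (addrA (f F)) [E *m (_ - D *m _)]mulmxBr mulmxA.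
  by move: (E *m (f F - Fo)) => Y; mx_abel.
apply: le_trans (ler_normD _ _) _; rewrite mulrDl lerD//.
  apply: le_trans (Hg _ fd) _; rewrite -mulrA ler_pM2l// -exprMn.
  by rewrite lerXn2r// nnegrE ?mulr_ge0// ltW.
by rewrite -(mulrA _ C); apply: mx_norm_mul_le => //; exact: Hf.
Qed.

Lemma quadratic_approx_diff f D : quadratic_approx f D ->
  differentiable f Fo /\ forall H, 'd f Fo H = D *m H.
Proof.
move=> qf; have fo := quadratic_approx_fixed qf; move: qf => [C C0 [d d0 Hf]].
pose df : {linear 'M[K]_(r, m) -> 'M[K]_(r, m)} := mulmx D.
have [||dif dE] := @quadratic_contact_diff _ _ _ f df Fo C d C0 d0.
- exact: mulmx_continuous.
- by move=> F Fd; rewrite fo -addrA -opprD; exact: Hf.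
- by split=> // H; rewrite dE.
Qed.

Lemma quadratic_approx_near f D e : quadratic_approx f D -> 0 < e ->
  \forall F \near Fo, `|f F - Fo| < e.
Proof.
move=> /quadratic_approx_lipschitz [L L0 [d d0 H]] e0; near=> F.
have Fd : `|F - Fo| <= d.
  by rewrite distrC; near: F; apply: (@cvgr_dist_le _ _ _ _ _ id) => //; exact: cvg_id.
apply: le_lt_trans (H _ Fd) _; rewrite -ltr_pdivlMl// mulrC distrC; near: F.
by apply: (@cvgr_dist_lt _ _ _ _ _ id); [exact: cvg_id | rewrite divr_gt0].
Unshelve. all: by end_near. Qed.

(** The gap [rho - s] absorbs the quadratic remainder near [Fo]. *)
Lemma quadratic_approx_rate f D (N : 'M[K]_(r, m) -> K) (s rho : K) :
  quadratic_approx f D -> is_norm N -> (forall X, N (D *m X) <= s * N X) ->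
  s < rho -> \forall F \near Fo, N (f F - Fo) <= rho * N (F - Fo).
Proof.
move=> [C C0 [d d0 H]] nN Ns srho.
have [N0 _ _ ND] := nN.
have [c c0 Nc] := is_norm_le nN; have [c' c'0 Nc'] := is_norm_ge nN.
near=> F.
have Fd : `|F - Fo| <= d.
  by rewrite distrC; near: F; apply: (@cvgr_dist_le _ _ _ _ _ id) => //; exact: cvg_id.
have Fe : `|F - Fo| <= (rho - s) / (c * C * c').
  rewrite distrC; near: F; apply: (@cvgr_dist_le _ _ _ _ _ id); first exact: cvg_id.
  by rewrite divr_gt0 ?subr_gt0// !mulr_gt0.
have -> : f F - Fo =
    (f F - (Fo + D *m (F - Fo))) + D *m (F - Fo) by rewrite opprD addrA subrK.
apply: le_trans (ND _ _) _.
have h1 : N (f F - (Fo + D *m (F - Fo))) <= c * (C * `|F - Fo| ^+ 2).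
  by apply: le_trans (Nc _) _; rewrite ler_pM2l// H.
have h2 : c * (C * `|F - Fo| ^+ 2) <= (rho - s) * N (F - Fo).
  apply: (@le_trans _ _ (c * C * `|F - Fo| * (c' * N (F - Fo)))).
    have -> : c * (C * `|F - Fo| ^+ 2) = c * C * `|F - Fo| * `|F - Fo| by ring.
    by rewrite ler_wpM2l ?mulr_ge0// ltW.
  have -> : c * C * `|F - Fo| * (c' * N (F - Fo)) =
    `|F - Fo| * (c * C * c') * N (F - Fo) by ring.
  by rewrite ler_wpM2r// -ler_pdivlMr// !mulr_gt0.
have := Ns (F - Fo); lra.
Unshelve. all: by end_near. Qed.

Lemma induced_normP (N : 'M[K]_(r, m) -> K) D : is_norm N ->
  0 <= induced_norm N D /\ forall X, N (D *m X) <= induced_norm N D * N X.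
Proof.
move=> nN; have [N0 Neq NZ _] := nN.
have [c c0 Nc] := is_norm_le nN; have [c' c'0 Nc'] := is_norm_ge nN.
have ub X : N X <= 1 -> N (D *m X) <= induced_norm N D.
  move=> X1; apply: sup_ubound; last by exists X.
  exists (c * (r%:R * `|D| * c')) => _ [Y /= Y1 <-].
  apply: le_trans (Nc _) _; rewrite ler_pM2l//; apply: mx_norm_mul_le => //.
  by apply: le_trans (Nc' _) _; rewrite ger_pMr.
split; first by have := ub 0; rewrite mulmx0 (is_norm0 nN); apply; exact: ler01.
move=> X; have [X0|X0] := eqVneq (N X) 0.
  by rewrite (Neq _ X0) mulmx0 (is_norm0 nN) mulr0.
have XP : 0 < N X by rewrite lt_neqAle eq_sym X0 N0.
have := ub ((N X)^-1 *: X); rewrite NZ normfV ger0_norm// mulVf// lexx => /(_ erefl).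
by rewrite -scalemxAr NZ normfV ger0_norm// ler_pdivrMl// mulrC.
Qed.

End QuadraticApproximation.

Section BlockUpdate.
Context {K : realType} {n : nat} {p q : 'I_n -> nat}.
Local Notation r := (\sum_i p i)%N.
Local Notation m := (\sum_i q i)%N.
Variables (A : 'M[K]_m) (B : 'M[K]_(m, r)) (Q : 'M[K]_m) (R : 'M[K]_r).
Variable Popt : 'M[K]_m.
Hypotheses (Qpos : sym_posdef Q) (Rpos : sym_posdef R) (Rdiag : block_diagonal R).
Hypothesis Psol : dare_solution A B Q R Popt.
Local Notation Fopt := (optimal_feedback A B R Popt).

(** Bound the factors of [block_update_remainder]: the inverse weight by the
    inverse of [subR], the difference of values by [sub_value_bracket]. *)
Lemma block_update_quadratic i :
  quadratic_approx Fopt (block_update A B Q R i) (Dblock_update B R Popt i).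
Proof.
have [c c0 [d /andP[d0 d1] Hb]] := sub_value_bracket Qpos Rpos Rdiag Psol.
have [a a0 Ha] := psd_norm_le (invmx (subR R i)).
have [b b0 Hb'] := psd_norm_le Popt.
set D := Dblock_update B R Popt i; have [[sP _] _] := Psol.
pose C := m%:R * (m%:R * ((p i)%:R * ((p i)%:R * `|@blk K n p i| * (a * 1)) *
  `|(@subB K n p q B i)^T|) * (b * c)) * (`|A| + r%:R * `|B| * (`|Fopt| + r%:R * `|D| * 1)).
have C0 : 0 <= C by rewrite /C !mulr_ge0// ?addr_ge0// ?mulr_ge0// ltW.
exists (1 + C); first by rewrite ltr_wpDr.
exists d => // F Fd; have [[pP _] lo hi] := Hb F i Fd.
rewrite (block_update_remainder Rpos Rdiag Psol pP) normrN.
apply: (@le_trans _ _ (C * `|F - Fopt| ^+ 2)); last first.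
  by rewrite mulrDl mul1r lerDr exprn_ge0.
set P := solve_dare _ _ _ _ in pP lo hi *; have [sPn _] := pP.
have pR := subR_posdef Rpos i; have pW := sub_weight_posdef B Rpos i pP.
have -> : C * `|F - Fopt| ^+ 2 = m%:R * (m%:R * ((p i)%:R * ((p i)%:R * `|@blk K n p i| * (a * 1)) *
  `|(@subB K n p q B i)^T|) * (b * (c * `|F - Fopt| ^+ 2))) *
  (`|A| + r%:R * `|B| * (`|Fopt| + r%:R * `|D| * 1)) by rewrite /C; ring.
apply: mx_norm_mul_le; first (apply: mx_norm_mul_le; first
  (apply: mx_norm_mul_le => //; apply: mx_norm_mul_le => //)).
- apply: Ha => //; first by apply: sym_invmx; case: pW.
  move=> x; rewrite mul1r; apply/andP; split; first exact/posdef_ge0/posdef_inv.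
  apply: posdef_inv_le => // y; rewrite qfD lerDl -qf_mulmx.
  exact: posdef_ge0.
- apply: Hb'; first by rewrite linearB /= sPn sP.
    by rewrite mulr_ge0 ?exprn_ge0// ltW.
  move=> x; rewrite qfD qfN subr_ge0 lo /=.
  by have := hi x; rewrite qfZ mulrDl mul1r lerBlDl.
- apply: le_trans (ler_normD _ _) _; rewrite lerD//.
  apply: mx_norm_mul_le => //; apply: le_trans (ler_normD _ _) _; rewrite lerD//.
  apply: mx_norm_mul_le => //; exact: le_trans Fd d1.
Qed.

End BlockUpdate.

(** * Energy norms *)

Section EnergyNorm.
Context {K : realType}.

(** The squared norm of the inner product that [M] induces on matrices, column by
    column. *)
Definition energy k a (M : 'M[K]_k) (X : 'M[K]_(k, a)) : K := \tr (X^T *m M *m X).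

Lemma energy_qf k a (M : 'M[K]_k) (X : 'M[K]_(k, a)) :
  energy M X = \sum_j qf M (col j X).
Proof.
rewrite /energy /mxtrace; apply: eq_bigr => j _.
rewrite /qf tr_col -row_mul [LHS]mxE [RHS]mxE.
by apply: eq_bigr => l _; rewrite [row _ _ _ _]mxE [col _ _ _ _]mxE.
Qed.

Lemma energy_ge0 k a (M : 'M[K]_k) (X : 'M[K]_(k, a)) : sym_posdef M ->
  0 <= energy M X.
Proof. by move=> pM; rewrite energy_qf sumr_ge0// => j _; exact: posdef_ge0. Qed.

Lemma energy_eq0 k a (M : 'M[K]_k) (X : 'M[K]_(k, a)) : sym_posdef M ->
  energy M X = 0 -> X = 0.
Proof.
move=> pM; rewrite energy_qf => /eqP; rewrite psumr_eq0; last first.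
  by move=> j _; exact: posdef_ge0.
move=> /allP H; apply/matrixP => i j; rewrite mxE.
have /eqP := H j (mem_index_enum _) => /(posdef_qf_eq0 pM)/matrixP/(_ i 0).
by rewrite !mxE.
Qed.

Lemma energyD k a (M : 'M[K]_k) (X Y : 'M[K]_(k, a)) : M^T = M ->
  energy M (X + Y) = energy M X + energy M Y + \tr (X^T *m M *m Y) *+ 2.
Proof.
move=> sM; rewrite /energy tr_addmx !(mulmxDl, mulmxDr) !mxtraceD.
have -> : \tr (Y^T *m M *m X) = \tr (X^T *m M *m Y).
  by rewrite -mxtrace_tr !trmx_mul trmxK sM mulmxA.
ring.
Qed.

Lemma energyZ k a (M : 'M[K]_k) t (X : 'M[K]_(k, a)) :
  energy M (t *: X) = t ^+ 2 * energy M X.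
Proof.
rewrite /energy [(t *: X)^T]linearZ /= -!scalemxAl -scalemxAr !mxtraceZ.
by rewrite expr2 mulrA.
Qed.

Lemma energy_CS k a (M : 'M[K]_k) (X Y : 'M[K]_(k, a)) : sym_posdef M ->
  \tr (X^T *m M *m Y) ^+ 2 <= energy M X * energy M Y.
Proof.
move=> pM; have [sM _] := pM; have Y0 := energy_ge0 Y pM.
have [y0|y0] := eqVneq (energy M Y) 0.
  by rewrite (energy_eq0 pM y0) mulmx0 mxtrace0 expr0n /= mulr_ge0// energy_ge0.
have yp : 0 < energy M Y by rewrite lt_neqAle eq_sym y0.
set b := \tr _; pose t := - (b / energy M Y).
have := energy_ge0 (X + t *: Y) pM; rewrite energyD// energyZ -scalemxAr mxtraceZ -/b.
have -> : energy M X + t ^+ 2 * energy M Y + t * b *+ 2 =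
  energy M X - b ^+ 2 / energy M Y by rewrite /t; field.
by rewrite subr_ge0 ler_pdivrMr.
Qed.

Lemma energy_is_norm k a (M : 'M[K]_k) : sym_posdef M ->
  is_norm (fun X : 'M[K]_(k, a) => Num.sqrt (energy M X)).
Proof.
move=> pM; have [sM _] := pM; split=> [X|X /eqP|t X|X Y].
- exact: sqrtr_ge0.
- by rewrite sqrtr_eq0 => e0; apply: (energy_eq0 pM); apply/eqP; rewrite eq_le e0 energy_ge0.
- by rewrite energyZ sqrtrM ?sqr_ge0// sqrtr_sqr.
have [x0 y0] := (energy_ge0 X pM, energy_ge0 Y pM).
rewrite -(ler_pXn2r (n := 2))// ?nnegrE ?addr_ge0 ?sqrtr_ge0//.
rewrite sqr_sqrtr ?energy_ge0// energyD// sqrrD !sqr_sqrtr//.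
rewrite addrAC lerD2r lerD2l lerMn2r /= -sqrtrM//.
apply: le_trans (ler_norm _) _; rewrite -sqrtr_sqr ler_wsqrtr//; exact: energy_CS.
Qed.

End EnergyNorm.

(** * The linearized cycle contracts the energy norm *)

Section Contraction.
Context {K : realType} {n : nat} {p q : 'I_n -> nat}.
Local Notation r := (\sum_i p i)%N.
Local Notation m := (\sum_i q i)%N.
Variables (B : 'M[K]_(m, r)) (R : 'M[K]_r) (Popt : 'M[K]_m).
Hypotheses (Rpos : sym_posdef R) (Rdiag : block_diagonal R) (Ppos : sym_posdef Popt).
Local Notation S := (input_weight B R Popt).
Local Notation D := (@Dblock_update K n p q B R Popt).
Local Notation Pi := (@blk K n p).
Local Notation V i := (invmx (input_weight (subB B i) (subR R i) Popt)).

Let Spos : sym_posdef S := input_weight_posdef B Rpos Ppos.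

(** A step of block Gauss-Seidel for [S]: since [R] is block diagonal, the terms
    of [S] that couple the blocks are those of [B^T Popt B]. *)
Lemma Dblock_updateE i : D i = 1%:M - Pi i *m V i *m (Pi i)^T *m S.
Proof.
have uW := posdef_unit (sub_weight_posdef B Rpos i Ppos).
have eW := sub_weight B R Popt i.
rewrite /Dblock_update /Dblock_row -/(input_weight (subB B i) (subR R i) Popt).
move: (input_weight (subB B i) _ _) uW eW => W uW eW.
have -> : Pi i *m invmx W *m (subB B i)^T *m Popt *m B *m coblk i =
   Pi i *m (invmx W *m ((Pi i)^T *m S *m coblk i)).
  by rewrite weight_cross// /subB trmx_mul !mulmxA.
have -> : (Pi i)^T *m S *m coblk i = (Pi i)^T *m S - W *m (Pi i)^T.
  by rewrite eW /coblk (mulmxBr _ 1%:M) mulmx1 !mulmxA.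
rewrite (mulmxBr (invmx W)) mulKmx//.
by rewrite mulmxBr opprB /coblk !mulmxA addrA subrK.
Qed.

(** Pythagoras' identity for an orthogonal projection of the inner product of
    [S]. *)
Lemma Dblock_update_energy i a (X : 'M[K]_(r, a)) :
  energy S (D i *m X) = energy S X - energy (V i) ((Pi i)^T *m S *m X).
Proof.
have pW := sub_weight_posdef B Rpos i Ppos; have uW := posdef_unit pW.
have [sS _] := Spos; have [sV _] := posdef_inv pW.
have eW : (Pi i)^T *m S *m Pi i *m V i = 1%:M by rewrite -sub_weight mulmxV.
rewrite Dblock_updateE mulmxBl mul1mx -!mulmxA.
set Z := (Pi i)^T *m (S *m X); rewrite energyD// mulmxN linearN /=.
have -> : \tr (X^T *m S *m (Pi i *m (V i *m Z))) = energy (V i) Z.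
  by rewrite /energy {2}/Z !trmx_mul trmxK sS !mulmxA.
have -> : energy S (- (Pi i *m (V i *m Z))) = energy (V i) Z.
  rewrite -scaleN1r energyZ sqrrN expr1n mul1r /energy; congr (\tr _).
  move: (invmx _) Z sV eW => W Z sV eW; rewrite !trmx_mul sV.
  have -> : Z^T *m W *m (Pi i)^T *m S *m (Pi i *m (W *m Z)) =
    Z^T *m W *m ((Pi i)^T *m S *m Pi i *m W *m Z) by rewrite !mulmxA.
  by rewrite eW mul1mx.
ring.
Qed.

Lemma Dblock_update_fixed i a (X : 'M[K]_(r, a)) :
  energy S X <= energy S (D i *m X) -> (Pi i)^T *m S *m X = 0 /\ D i *m X = X.
Proof.
have pV := posdef_inv (sub_weight_posdef B Rpos i Ppos).
rewrite Dblock_update_energy lerBrDr gerDl => le0.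
have Z0 : (Pi i)^T *m S *m X = 0.
  by apply: (energy_eq0 pV); apply/eqP; rewrite eq_le le0 energy_ge0.
by split=> //; rewrite Dblock_updateE mulmxBl mul1mx -!mulmxA (mulmxA _ S) Z0 !mulmx0 subr0.
Qed.

Lemma Dblock_update_le i a (X : 'M[K]_(r, a)) : energy S (D i *m X) <= energy S X.
Proof.
have pV := posdef_inv (sub_weight_posdef B Rpos i Ppos).
by rewrite Dblock_update_energy gerBl energy_ge0.
Qed.

(** The partial products of [Dcycle], for inductions along the sweep. *)
Definition Dsteps j k : 'M[K]_r :=
  \big[mulmx/1%:M]_(l <- rev (iota 0 k)) D (sweep j l).

Lemma Dsteps0 j : Dsteps j 0 = 1%:M.
Proof. by rewrite /Dsteps big_nil. Qed.

Lemma DstepsS j k : Dsteps j k.+1 = D (sweep j k) *m Dsteps j k.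
Proof. by rewrite /Dsteps -addn1 iotaD rev_cat big_cons. Qed.

Lemma sweepE (j : 'I_n) k : sweep j k = ((j + k) %% n)%N :> nat.
Proof.
elim: k => [|k IH]; first by rewrite addn0 modn_small.
by rewrite /sweep iterS /= -/(sweep j k) IH addnS -addn1 modnDml addn1.
Qed.

Lemma sweep_covers (j i : 'I_n) : exists2 k, (k < n)%N & sweep j k = i.
Proof.
have n0 : (0 < n)%N by exact: leq_ltn_trans (leq0n j) (ltn_ord j).
exists ((i + (n - j)) %% n)%N; first by rewrite ltn_mod.
apply: val_inj; rewrite /= sweepE modnDmr addnCA subnKC 1?ltnW//.
by rewrite modnDr modn_small.
Qed.

(** If a full sweep does not decrease the energy of [X], no step does, so every
    step fixes [X] and [S X] vanishes in every block. *)
Lemma Dcycle_decrease j a (X : 'M[K]_(r, a)) : X != 0 ->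
  energy S (Dcycle B R Popt j *m X) < energy S X.
Proof.
move=> X0; rewrite ltNge; apply: contraNN X0 => le1.
have dec k : energy S (Dsteps j k.+1 *m X) <= energy S (Dsteps j k *m X).
  by rewrite DstepsS -mulmxA Dblock_update_le.
have decr k l : (k <= l)%N -> energy S (Dsteps j l *m X) <= energy S (Dsteps j k *m X).
  move=> /subnK <-; elim: (l - k)%N => //= d; apply: le_trans.
  by rewrite addSn.
have ge1 k : (k <= n)%N -> energy S X <= energy S (Dsteps j k *m X).
  by move=> kn; exact: le_trans le1 (decr _ _ kn).
have le2 k : energy S (Dsteps j k *m X) <= energy S X.
  by have := decr 0%N k (leq0n _); rewrite Dsteps0 mul1mx.
have fix_ k : (k <= n)%N -> Dsteps j k *m X = X.
  elim: k => [|k IH] kn; first by rewrite Dsteps0 mul1mx.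
  have := ge1 _ kn; rewrite DstepsS -mulmxA IH 1?ltnW//.
  by move=> /Dblock_update_fixed[].
have SX0 : S *m X = 0.
  apply: tr_blk_inj => i; rewrite mulmx0 mulmxA.
  have [k kn <-] := sweep_covers j i.
  have := ge1 _ kn; rewrite DstepsS -mulmxA (fix_ _ (ltnW kn)).
  by move=> /Dblock_update_fixed[].
by rewrite -(mulKmx (posdef_unit Spos) X) SX0 mulmx0.
Qed.

Lemma Dcycle_contraction j : exists2 rho : K, 0 < rho < 1 &
  forall X : 'M[K]_(r, m),
    Num.sqrt (energy S (Dcycle B R Popt j *m X)) <= rho * Num.sqrt (energy S X).
Proof.
apply: (strict_decrease_contraction (energy_is_norm m Spos)) => X X0.
rewrite ltr_sqrt ?Dcycle_decrease// lt_neqAle energy_ge0// andbT eq_sym.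
by apply: contra_neq X0; exact: energy_eq0.
Qed.

End Contraction.

(** * The iteration near the optimal feedback *)

Section Iteration.
Context {K : realType} {n : nat} {p q : 'I_n -> nat}.
Local Notation r := (\sum_i p i)%N.
Local Notation m := (\sum_i q i)%N.
Variables (A : 'M[K]_m) (B : 'M[K]_(m, r)) (Q : 'M[K]_m) (R : 'M[K]_r).
Variable Popt : 'M[K]_m.
Hypotheses (Qpos : sym_posdef Q) (Rpos : sym_posdef R) (Rdiag : block_diagonal R).
Hypothesis Psol : dare_solution A B Q R Popt.
Local Notation Fopt := (optimal_feedback A B R Popt).
Local Notation iterate := (split_iter A B Q R).
Local Notation N_estimate N rho F :=
  (forall i, N (full_cycle A B Q R i F - Fopt) <= rho * N (F - Fopt)).

Lemma split_iter_add j F k l :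
  iterate j F (k + l) = iterate (sweep j k) (iterate j F k) l.
Proof.
elim: l => [|l IH]; first by rewrite addn0.
by rewrite addnS /= IH /sweep addnC iterD.
Qed.

Lemma split_iter_quadratic j k :
  quadratic_approx Fopt (fun F => iterate j F k) (Dsteps B R Popt j k).
Proof.
elim: k => [|k IH]; first by rewrite Dsteps0; exact: quadratic_approx_id.
rewrite DstepsS.
exact: (quadratic_approx_comp IH (block_update_quadratic Qpos Rpos Rdiag Psol _)).
Qed.

Lemma full_cycle_quadratic j :
  quadratic_approx Fopt (full_cycle A B Q R j) (Dcycle B R Popt j).
Proof. exact: split_iter_quadratic. Qed.

(** The cycle performed by the [n] updates after step [k] begins with
    [sweep j k], so the estimate reduces to those for single cycles. *)
Lemma local_linear_estimate_near j (N : 'M[K]_(r, m) -> K) rho (S : pred nat) :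
  (forall i, \forall F \near Fopt, (exists2 k, S k & sweep j k = i) ->
     N (full_cycle A B Q R i F - Fopt) <= rho * N (F - Fopt)) ->
  local_linear_estimate A B Q R j Fopt N rho S.
Proof.
move=> H; exists [set F | forall i, (exists2 k, S k & sweep j k = i) ->
     N (full_cycle A B Q R i F - Fopt) <= rho * N (F - Fopt)].
  exact: (@filter_forall _ _ _ _ (nbhs_filter _) H).
move=> F0 k _ Sk UF; rewrite split_iter_add.
by apply: (UF (sweep j k)); exists k.
Qed.

(** The iterates stay in the neighbourhood on which a full cycle contracts:
    those of the first cycle by continuity, the later ones by induction. *)
Lemma split_iter_cvg j (N : 'M[K]_(r, m) -> K) rho : is_norm N -> 0 < rho < 1 ->
  (forall i, \forall F \near Fopt,
     N (full_cycle A B Q R i F - Fopt) <= rho * N (F - Fopt)) ->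
  \forall F0 \near Fopt, iterate j F0 k @[k --> \oo] --> Fopt.
Proof.
move=> nN /andP[rho0 rho1] Hi; have [N0 _ _ _] := nN.
have n0 : (0 < n)%N by exact: leq_ltn_trans (leq0n j) (ltn_ord j).
have : \forall F \near Fopt, N_estimate N rho F.
  exact: (@filter_forall _ _ _ _ (nbhs_filter _) Hi).
move=> /nbhs_normP[e /= e0 He].
have [c c0 Nc] := is_norm_le nN; have [c' c'0 Nc'] := is_norm_ge nN.
pose d := e / c'; have d0 : 0 < d by rewrite divr_gt0.
have small F : N (F - Fopt) < d -> N_estimate N rho F.
  move=> Fd; apply: He; rewrite /= distrC; apply: le_lt_trans (Nc' _) _.
  by rewrite -ltr_pdivlMl// mulrC.
have first1 (k : 'I_n) : \forall F0 \near Fopt, N (iterate j F0 k - Fopt) < d.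
  have dc : 0 < d / c by rewrite divr_gt0.
  have := quadratic_approx_near (split_iter_quadratic j k) dc.
  apply: filterS => F Fd; apply: le_lt_trans (Nc _) _.
  by rewrite -ltr_pdivlMl// mulrC.
have := @filter_forall _ _ _ _ (nbhs_filter _) first1.
apply: filterS => F0 F0d.
have cyc t k : (k < n)%N -> N (iterate j F0 (t * n + k) - Fopt) <= rho ^+ t * d
    /\ N (iterate j F0 (t * n + k) - Fopt) < d.
  move=> kn; elim: t => [|t [IH IHd]].
    by rewrite mul0n add0n expr0 mul1r ltW (F0d (Ordinal kn)).
  have := small _ IHd (sweep j (t * n + k)).
  rewrite -/(full_cycle _ _ _ _ _ _) /full_cycle -split_iter_add.
  have -> : (t * n + k + n = t.+1 * n + k)%N by rewrite mulSn addnC addnA.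
  move=> le1; split.
    by apply: le_trans le1 _; rewrite exprS -mulrA ler_pM2l.
  by apply: le_lt_trans le1 _; apply: le_lt_trans IHd; rewrite ler_piMl// ltW.
apply/cvgrPdist_le => eps eps0.
have rho1' : `|rho| < 1 by rewrite ger0_norm// ltW.
have /cvgrPdist_le/(_ _ eps0)[t0 _ Ht] := cvg_geometric (c' * d) rho1'.
exists (t0 * n)%N => // l /= tl; rewrite distrC; apply: le_trans (Nc' _) _.
have lt0 : (t0 <= l %/ n)%N by rewrite leq_divRL.
have [le1 _] := cyc (l %/ n)%N (l %% n)%N (ltn_pmod l n0).
rewrite -divn_eq in le1.
apply: (@le_trans _ _ (c' * d * rho ^+ (l %/ n))).
  by rewrite -mulrA ler_pM2l// mulrC.
have := Ht _ lt0; rewrite sub0r normrN /= => /(le_trans _); apply; exact: ler_norm.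
Qed.

End Iteration.

Theorem theorem10 (K : realType) (n : nat) (p q : 'I_n -> nat)
    (A : 'M[K]_(\sum_i q i)) (B : 'M[K]_(\sum_i q i, \sum_i p i))
    (Q : 'M[K]_(\sum_i q i)) (R : 'M[K]_(\sum_i p i))
    (Popt : 'M[K]_(\sum_i q i)) (j : 'I_n)
    (Qpos : sym_posdef Q) (Qdiag : block_diagonal Q)
    (Rpos : sym_posdef R) (Rdiag : block_diagonal R)
    (Psol : dare_solution A B Q R Popt) :
  let Fopt := optimal_feedback A B R Popt in
  [/\ (* the derivatives of the g^i and of g *)
      (forall i : 'I_n,
         differentiable (block_update A B Q R i) Fopt /\
         forall H, 'd (block_update A B Q R i) Fopt H = Dblock_update B R Popt i *m H),
      differentiable (full_cycle A B Q R j) Fopt /\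
        (forall H, 'd (full_cycle A B Q R j) Fopt H = Dcycle B R Popt j *m H),
      (* local linear convergence *)
      (exists (N : 'M[K]_(\sum_i p i, \sum_i q i) -> K) (rho : K),
         [/\ is_norm N, 0 < rho < 1
           & local_linear_estimate A B Q R j Fopt N rho predT]) /\
      (\forall F0 \near Fopt, admissible_start A B j F0 ->
         split_iter A B Q R j F0 k @[k --> \oo] --> Fopt),
      (forall N : 'M[K]_(\sum_i p i, \sum_i q i) -> K, is_norm N ->
         exists2 rho : K, 0 < rho
           & local_linear_estimate A B Q R j Fopt N rho predT)
    & (* the rate is governed by the norm of the iteration matrix of the cycle
         that starts at the current iterate *)
      forall N : 'M[K]_(\sum_i p i, \sum_i q i) -> K, is_norm N ->
      forall (i : 'I_n) (rho : K), induced_norm N (Dcycle B R Popt i) < rho ->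
        local_linear_estimate A B Q R j Fopt N rho
          [pred k | sweep j k == i]].
Proof.
move=> Fopt.
have qcyc i := full_cycle_quadratic Qpos Rpos Rdiag Psol i.
have Spos := input_weight_posdef B Rpos Psol.1.
split.
- by move=> i; exact: quadratic_approx_diff (block_update_quadratic _ _ _ _ _).
- exact: quadratic_approx_diff.
- have [Ppos _] := Psol.
  pose N (X : 'M[K]_(\sum_i p i, \sum_i q i)) :=
    Num.sqrt (energy (input_weight B R Popt) X).
  have nN : is_norm N by exact: energy_is_norm.
  have /choice[s Hs] : forall i : 'I_n, exists s : K, 0 < s < 1 /\
      forall X : 'M[K]_(\sum_i p i, \sum_i q i), N (Dcycle B R Popt i *m X) <= s * N X.
    by move=> i; have [s s1 Ns] := Dcycle_contraction B Rpos Rdiag Ppos i; exists s.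
  pose s0 := \big[Num.max/0]_i s i.
  have s01 : s0 < 1 by apply: bigmax_lt => // i _; have [/andP[]] := Hs i.
  have s00 : 0 <= s0 by exact: bigmax_ge_id.
  pose rho := (1 + s0) / 2.
  have rho01 : 0 < rho < 1 by apply/andP; split; rewrite /rho; lra.
  have near_ i : \forall F \near Fopt,
      N (full_cycle A B Q R i F - Fopt) <= rho * N (F - Fopt).
    have [_ Ns] := Hs i; apply: quadratic_approx_rate (qcyc i) nN Ns _.
    by apply: (@le_lt_trans _ _ s0); [exact: le_bigmax | rewrite /rho; lra].
  split.
    exists N, rho; split=> //; apply: local_linear_estimate_near => i.
    by apply: filterS (near_ i) => F HF _.
  have := split_iter_cvg Qpos Rpos Rdiag Psol j nN rho01 near_.
  by apply: filterS => F HF _.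
- move=> N nN; pose rho := 1 + \sum_i induced_norm N (Dcycle B R Popt i).
  have i0 i := (induced_normP (Dcycle B R Popt i) nN).1.
  exists rho; first by rewrite ltr_wpDr// sumr_ge0.
  apply: local_linear_estimate_near => i.
  have [_ Ni] := induced_normP (Dcycle B R Popt i) nN.
  have lt1 : induced_norm N (Dcycle B R Popt i) < rho.
    rewrite /rho [X in _ < 1 + X](bigD1 i)//=.
    have : 0 <= \sum_(l | l != i) induced_norm N (Dcycle B R Popt l) by rewrite sumr_ge0.
    by move: (i0 i); lra.
  by have := quadratic_approx_rate (qcyc i) nN Ni lt1; apply: filterS => F HF _.
- move=> N nN i rho lt1; apply: local_linear_estimate_near => l.
  have [_ Ni] := induced_normP (Dcycle B R Popt i) nN.
  have := quadratic_approx_rate (qcyc i) nN Ni lt1; apply: filterS => F HF.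
  by move=> [k /= /eqP ki kl]; rewrite -kl ki.
Qed.
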